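(* Let $n,p,N$ be positive integers with $2\le p\le N+1$ and let $\tau=\{t_0,\dots,t_N\}$ with real numbers $t_0<t_1<\dots<t_N$. There exists a constant $C_0=C_0(p,\tau)>0$ (depending only on $p$ and $\tau$) such that, for all $j\in\{0,\dots,N\}$, all $m\in\{0,\dots,2p-2\}$, and all $\xi\in\mathbb{R}^n$ with $|\xi|\ge\frac12$, $$\left|\frac{d^m}{dt^m}L_{\xi,j}(t)\right|\le C_0\,(1+|\xi|^m),\qquad\forall t\in\mathbb{R}.$$
   Context: $|\xi|$ is the Euclidean norm of $\xi\in\mathbb{R}^n$. Set $t_{-1}:=-\infty$, $t_{N+1}:=\infty$. For $\xi\in\mathbb{R}^n\setminus\{0\}$ let $\mathcal{L}_\xi:=\left(\frac{d^2}{dt^2}-|\xi|^2\right)^p$. A function $s:\mathbb{R}\to\mathbb{C}$ is a natural $\mathcal{L}_\xi$-spline on $\tau$ if: (i) $s\in C^{2p-2}(\mathbb{R})$; (ii) $\mathcal{L}_\xi s(t)=0$ for all $t\in(t_{j-1},t_j)$ and all $j\in\{0,1,\dots,N+1\}$; (iii) $\left(\frac{d}{dt}-|\xi|\right)^p s(t)=0$ for all $t<t_0$, and $\left(\frac{d}{dt}+|\xi|\right)^p s(t)=0$ for all $t>t_N$. The space of all natural $\mathcal{L}_\xi$-splines on $\tau$ is denoted $\mathcal{S}_{p,\xi}(\tau)$. For each $j\in\{0,\dots,N\}$, the Lagrange function $L_{\xi,j}$ is the unique element of $\mathcal{S}_{p,\xi}(\tau)$ with $L_{\xi,j}(t_j)=1$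 and $L_{\xi,j}(t_k)=0$ for $k\in\{0,\dots,N\}\setminus\{j\}$ (such a function exists and is unique). *)

(* Defs.v *)
From HB Require Import structures.
From mathcomp Require Import all_boot all_order all_algebra.
From mathcomp Require Import complex.
From mathcomp Require Import all_classical all_reals all_analysis.

Set Implicit Arguments.
Unset Strict Implicit.
Unset Printing Implicit Defensive.

Import Order.TTheory GRing.Theory Num.Theory.
Import numFieldNormedType.Exports.

Local Open Scope ring_scope.
Local Open Scope classical_set_scope.
Local Open Scope complex_scope.

(* The library norm [`|xi|] on ['rV_n] is the sup norm. *)
Definition enorm (R : realType) (n : nat) (xi : 'rV[R]_n) : R :=
  Num.sqrt (\sum_(i < n) xi ord0 i ^+ 2).

Definition re_part (R : realType) (s : R -> R[i]) (t : R) : R :=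
  complex.Re (s t).

Definition im_part (R : realType) (s : R -> R[i]) (t : R) : R :=
  complex.Im (s t).

(* [R[i]] carries no normed structure over [R] in the library, so functions
   [R -> R[i]] of a real variable are differentiated componentwise. *)
Definition cderiven (R : realType) (m : nat) (s : R -> R[i]) (t : R) : R[i] :=
  (re_part s)^`(m) t +i* (im_part s)^`(m) t.

(* [f^`(m)] is total, with unspecified values where [f] is not differentiable;
   [diffn_on k A s] says that the derivatives of [s] of order at most [k]
   genuinely exist at every point of [A] (used for open [A]). *)
Definition diffn_on (R : realType) (k : nat) (A : set R) (s : R -> R[i]) : Prop :=
  forall (i : nat) (t : R), (i < k)%N -> A t ->
    derivable (re_part s)^`(i) t 1 /\ derivable (im_part s)^`(i) t 1.

Definition class_C (R : realType) (k : nat) (s : R -> R[i]) : Prop :=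
  [/\ diffn_on k setT s,
      continuous (re_part s)^`(k) & continuous (im_part s)^`(k)].

(* [(d/dt + a)^p] *)
Definition first_order_op (R : realType) (p : nat) (a : R) (s : R -> R[i]) :
    R -> R[i] :=
  iter p (fun u t => cderiven 1 u t + a%:C * u t) s.

(* [(d^2/dt^2 - |xi|^2)^p] *)
Definition Lop (R : realType) (n p : nat) (xi : 'rV[R]_n) (s : R -> R[i]) :
    R -> R[i] :=
  iter p (fun u t => cderiven 2 u t - (enorm xi ^+ 2)%:C * u t) s.

(* Knots shifted by one: [xknot t 0 = t_{-1} = -oo], [xknot t k.+1 = t_k] for
   [k <= N], and [xknot t N.+2 = t_{N+1} = +oo]. *)
Definition xknot (R : realType) (N : nat) (t : 'I_N.+1 -> R) (k : nat) : \bar R :=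
  if k is k'.+1 then
    (if insub k' is Some i then (t i)%:E else +oo%E)
  else -oo%E.

(* The open interval [(t_{j-1}, t_j)]. *)
Definition piece (R : realType) (N : nat) (t : 'I_N.+1 -> R) (j : nat) : set R :=
  [set x | (xknot t j < x%:E)%E /\ (x%:E < xknot t j.+1)%E].

(* [diffn_on] also covers the two unbounded pieces [j = 0] and [j = N+1], so the
   last two clauses need no differentiability condition of their own. *)
Definition natural_spline (R : realType) (n p N : nat) (t : 'I_N.+1 -> R)
    (xi : 'rV[R]_n) (s : R -> R[i]) : Prop :=
  [/\ class_C (2 * p - 2) s,
      forall j : 'I_N.+2, diffn_on (2 * p) (piece t j) s /\
        (forall x : R, piece t j x -> Lop p xi s x = 0),
      forall x : R, x < t ord0 -> first_order_op p (- enorm xi) s x = 0 &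
      forall x : R, t ord_max < x -> first_order_op p (enorm xi) s x = 0].

Definition is_lagrange (R : realType) (n p N : nat) (t : 'I_N.+1 -> R)
    (xi : 'rV[R]_n) (j : 'I_N.+1) (s : R -> R[i]) : Prop :=
  [/\ natural_spline p t xi s,
      s (t j) = 1 &
      forall k : 'I_N.+1, k != j -> s (t k) = 0].

(* Main.v *)
(* The real and imaginary parts of L are real splines with values at most 1 at
   the knots. Rescaling t = x/|xi| reduces to |xi| = 1, with knots whose gaps
   stay bounded below because |xi| >= 1/2; it remains to bound all derivatives
   by a constant depending only on p, N and the smallest gap.

   With e(u, w) = sum_k C(p, k) u^(k) w^(k), a natural spline u minimizes the
   energy, the integral of e(u, u), among functions with the same values at the
   knots, so its energy is bounded by that of a sum of bumps. To avoid integrals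
   we follow an explicit antiderivative G of e(u, u), which tends to 0 at both
   infinities, increases between the knots, and drops by a bounded amount at
   each knot. Hence G is bounded, which bounds u because
   (u^2)' <= e(u, u) = G'. Finally u solves a linear ODE of order 2p between the
   knots, so Landau's inequality bounds the derivatives of u in terms of u. *)
Require Import Defs.
From HB Require Import structures.
From mathcomp Require Import all_boot all_order all_algebra.
From mathcomp Require Import complex ring lra zify.
From mathcomp Require Import all_classical all_reals all_analysis.

Set Implicit Arguments.
Unset Strict Implicit.
Unset Printing Implicit Defensive.

Import Order.TTheory GRing.Theory Num.Theory.
Import numFieldNormedType.Exports.

Local Open Scope ring_scope.
Local Open Scope classical_set_scope.
Local Open Scope complex_scope.

(** * Rules for derivatives and mean value inequalities on the real line *)

Section RealDerivatives.
Context {R : realType}.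
Implicit Types (f g : R -> R) (x y a b : R).

Lemma derD f g x a b : is_derive x 1 f a -> is_derive x 1 g b ->
  is_derive x 1 (fun y => f y + g y) (a + b).
Proof. exact: is_deriveD. Qed.

Lemma derM f g x a b : is_derive x 1 f a -> is_derive x 1 g b ->
  is_derive x 1 (fun y => f y * g y) (a * g x + f x * b).
Proof.
move=> fa gb; have := is_deriveM fa gb.
by rewrite addrC /GRing.scale/= [g x * a]mulrC.
Qed.

Lemma derZ c f x a : is_derive x 1 f a -> is_derive x 1 (fun y => c * f y) (c * a).
Proof. by move=> fa; have := is_deriveZ c fa. Qed.

Lemma der_sum n (F : 'I_n -> R -> R) (dF : 'I_n -> R) x :
  (forall i, is_derive x 1 (F i) (dF i)) ->
  is_derive x 1 (fun y => \sum_(i < n) F i y) (\sum_(i < n) dF i).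
Proof.
move=> dFx; suff -> : (fun y => \sum_(i < n) F i y) = \sum_(i < n) F i by exact: is_derive_sum.
by apply/funext => y; rewrite fct_sumE.
Qed.

Lemma der_comp_affine f c d x a : is_derive (c * x + d) 1 f a ->
  is_derive x 1 (fun y => f (c * y + d)) (c * a).
Proof.
move=> fa; have h : is_derive x 1 (fun y => c * y + d) c.
  by have := derD (derZ c (is_derive_id x 1)) (is_derive_cst d x 1); rewrite mulr1 addr0.
by rewrite (mulrC c a); exact: (@is_derive1_comp _ f (fun y => c * y + d)). 
Qed.

Lemma der_continuous f x a : is_derive x 1 f a -> {for x, continuous f}.
Proof. by case=> fx _; exact/differentiable_continuous/derivable1_diffP. Qed.

Lemma der_continuous_within f (f' : R -> R) a b :
  (forall x, a <= x <= b -> is_derive x 1 f (f' x)) ->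
  {within `[a, b], continuous f}.
Proof.
move=> fab; apply: derivable_within_continuous => x.
by rewrite in_itv/= => /fab [].
Qed.

Lemma mean_value f (f' : R -> R) a b : a < b ->
  (forall x, a <= x <= b -> is_derive x 1 f (f' x)) ->
  exists2 c, a < c < b & f b - f a = f' c * (b - a).
Proof.
move=> ab fab; have [|| c] := @MVT R f f' a b ab.
- by move=> x; rewrite in_itv/= => /andP[ax xb]; apply: fab; rewrite !ltW.
- exact: der_continuous_within fab.
- by rewrite in_itv/=; exists c.
Qed.

Lemma der_ge0_le f (f' : R -> R) a b : a <= b ->
  (forall x, a <= x <= b -> is_derive x 1 f (f' x)) ->
  (forall x, a <= x <= b -> 0 <= f' x) -> f a <= f b.
Proof.
rewrite le_eqVlt => /predU1P[->//|ab] fab f0.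
have [c /andP[ac cb] fE] := mean_value ab fab.
by rewrite -subr_ge0 fE mulr_ge0// ?f0 ?subr_ge0 ?ltW.
Qed.

Lemma der_le_le f (f' : R -> R) g (g' : R -> R) a b : a <= b ->
  (forall x, a <= x <= b -> is_derive x 1 f (f' x)) ->
  (forall x, a <= x <= b -> is_derive x 1 g (g' x)) ->
  (forall x, a <= x <= b -> f' x <= g' x) -> f b - f a <= g b - g a.
Proof.
move=> ab fab gab fg.
have := @der_ge0_le (fun x => g x + -1 * f x) (fun x => g' x + -1 * f' x) a b ab.
suff h : g a + -1 * f a <= g b + -1 * f b -> f b - f a <= g b - g a.
  move=> /(_ _ _)/h; apply => x xab.
    by apply: derD; [exact: gab|apply: derZ; exact: fab].
  by have := fg x xab; lra.
lra.
Qed.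

Lemma der_le_lipschitz f (f' : R -> R) K a b : 
  (forall x, a <= x <= b -> is_derive x 1 f (f' x)) ->
  (forall x, a <= x <= b -> `|f' x| <= K) ->
  forall x y, a <= x <= b -> a <= y <= b -> `|f y - f x| <= K * (b - a).
Proof.
move=> fab fK; suff h x y : x <= y -> a <= x -> y <= b -> `|f y - f x| <= K * (b - a).
  move=> x y /andP[ax xb] /andP[ay yb]; case: (lerP x y) => xy; first exact: h.
  by rewrite distrC; apply: h => //; exact: ltW.
rewrite le_eqVlt => /predU1P[<-|xy] ax xb.
  rewrite subrr normr0 mulr_ge0 ?subr_ge0 ?(le_trans ax)//.
  by apply: le_trans (normr_ge0 (f' x)) (fK _ _); rewrite ax.
have [z zab|z /andP[xz zy] ->] := @mean_value f f' x y xy.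
  by apply: fab; move: zab; lra.
rewrite normrM ler_pM// ?fK//; last by rewrite ger0_norm; lra.
by apply/andP; lra.
Qed.

Lemma near_lt_gt x a b : a < x < b -> \forall y \near x, a < y < b.
Proof.
move=> xab; have : x \in `]a, b[%R by rewrite in_itv/=.
by move/near_in_itvoo; move=> h; apply: filterS h => y /=; rewrite in_itv.
Qed.

Lemma der_local f g x a l r : l < x < r -> (forall y, l < y < r -> f y = g y) ->
  is_derive x 1 f a -> is_derive x 1 g a.
Proof.
move=> xlr fg; apply: near_eq_is_derive.
by near=> y; apply: fg; near: y; exact: near_lt_gt.
Unshelve. all: by end_near. Qed.

End RealDerivatives.

(* [u k] plays the role of the [k]-th derivative of [u 0]. *)
Definition jet_on (R : realType) (n : nat) (A : set R) (u : nat -> R -> R) :=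
  forall k x, (k < n)%N -> A x -> is_derive x 1 (u k) (u k.+1 x).

(** * Bounds for the derivatives of a function in terms of the function *)

Section Landau.
Context {R : realType}.
Implicit Types (u : nat -> R -> R) (x y a b : R).

Lemma jet_on_sub n m (A B : set R) u : (m <= n)%N -> B `<=` A ->
  jet_on n A u -> jet_on m B u.
Proof. by move=> mn BA uA k x km /BA Ax; apply: uA => //; exact: leq_trans mn. Qed.

(** By induction, the outer thirds of the window each contain a point where the [k]-th derivative is
    at most [B * M]. These points are at least [d / 3] apart, so by the mean value theorem the next
    derivative is small somewhere between them. *)
Lemma exists_small_derivative k d : 0 < d -> exists2 B : R, 0 <= B &
  forall u a M, jet_on k [set x | a <= x <= a + d] u ->
    (forall x, a <= x <= a + d -> `|u 0%N x| <= M) ->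
    exists2 x, a <= x <= a + d & `|u k x| <= B * M.
Proof.
elim: k d => [|k IHk] d d0.
  exists 1 => // u a M _ uM; exists a; first by lra.
  by rewrite mul1r uM//; lra.
have [|B B0 hB] := IHk (d / 3); first by rewrite divr_gt0.
exists (2 * B / (d / 3)); first by rewrite divr_ge0 ?mulr_ge0//; lra.
move=> u a M ju uM.
have M0 : 0 <= M by apply: le_trans (normr_ge0 _) (uM a _); lra.
have [||x1 x1a ux1] := hB u a M.
- by apply: jet_on_sub ju => // z /=; lra.
- by move=> z za; apply: uM; lra.
have [||x2 x2a ux2] := hB u (a + 2 * (d / 3)) M.
- by apply: jet_on_sub ju => // z /=; lra.
- by move=> z za; apply: uM; lra.
have x12 : x1 < x2 by lra.
have [z zx|z zx uE] := @mean_value R (u k) (u k.+1) x1 x2 x12.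
  by apply: ju => //=; lra.
exists z; first by lra.
have h : `|u k x2 - u k x1| <= 2 * B * M.
  by apply: le_trans (ler_normB _ _) _; lra.
have gap : d / 3 <= x2 - x1 by lra.
move: h; rewrite uE normrM (ger0_norm (_ : 0 <= x2 - x1)); last by lra.
move=> h; rewrite mulrAC ler_pdivlMr ?divr_gt0//.
by apply: le_trans h; apply: ler_wpM2l.
Qed.

(* Landau's argument: on a window of length [eps] each [u k] is bounded by a
   multiple of [M] at some point, and varies by at most [eps * (K + 1) * Y xm],
   where [xm] maximizes [Y = \sum_k |u k|]; for small [eps] this bounds [Y xm]. *)
Lemma jet_bound n (K l : R) : 0 <= K -> 0 < l -> exists2 C : R, 0 <= C &
  forall u a b M, l <= b - a -> jet_on n [set x | a <= x <= b] u ->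
    (forall x, a <= x <= b -> `|u n x| <= K * \sum_(k < n) `|u k x|) ->
    (forall x, a <= x <= b -> `|u 0%N x| <= M) ->
    forall k x, (k < n)%N -> a <= x <= b -> `|u k x| <= C * M.
Proof.
move=> K0 l0; set q := n%:R * (K + 1) + 1.
have q1 : 1 <= q by rewrite lerDr mulr_ge0//; lra.
(* The first bound lets the window fit into [[a, b]]; the second makes [n * eps * (K + 1)] at most
   1/2, so that the term in [Y xm] can be absorbed on the left. *)
pose eps := Num.min l (2 * q)^-1.
have eps0 : 0 < eps by rewrite lt_min l0 invr_gt0; lra.
have /= := fun k : 'I_n => exists_small_derivative k eps0.
move=> /(_ _)/cid2-/all_sig2[B B0 hB].
exists (2 * \sum_(k < n) B k) => [|u a b M lab ju uK uM].
  by rewrite mulr_ge0// sumr_ge0.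
suff main c x : a <= c -> c + eps <= b -> c <= x <= c + eps ->
    \sum_(k < n) `|u k x| <= 2 * (\sum_(k < n) B k) * M.
  move=> k x kn xab; have el : eps <= l by rewrite ge_min lexx.
  suff : \sum_(k < n) `|u k x| <= 2 * (\sum_(k < n) B k) * M.
    apply: le_trans; rewrite (bigD1 (Ordinal kn))//= lerDl sumr_ge0//.
  have [xb|xb] := lerP (x + eps) b; first by apply: (main x) => //; lra.
  by apply: (main (b - eps)); lra.
move=> ac cb xc; set Y : R -> R := fun x => \sum_(k < n) `|u k x|.
have jc : jet_on n [set x | c <= x <= c + eps] u.
  by apply: jet_on_sub ju => // z /=; lra.
have Yc : {within `[c, c + eps], continuous Y}.
  apply: (@continuous_big R 'I_n +%R 0 xpredT add_continuous
    (subspace `[c, c + eps]) (index_enum _) (fun k x => `|u k x|)) => k _ z.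
  apply: (@cvg_norm _ R); have := @der_continuous_within R (u k) (u k.+1) c (c + eps).
  by move=> h; apply: h => y yc; apply: jc.
have [||xm] := @EVT_max R Y c (c + eps) => //; first by lra.
rewrite in_itv/= => xmc Ymax.
have {Ymax}Ymax y : c <= y <= c + eps -> Y y <= Y xm.
  by move=> yc; apply: Ymax; rewrite in_itv.
have Y0 y : 0 <= Y y by rewrite sumr_ge0.
(* Either [u k.+1] is one of the summands of [Y], or [k.+1 = n] and the differential inequality [uK]
   applies. *)
have unext (k : 'I_n) y : c <= y <= c + eps -> `|u k.+1 y| <= (K + 1) * Y xm.
  move=> yc; have YE := Ymax y yc.
  have [k1n|] := ltnP k.+1 n.
    apply: (@le_trans _ _ (Y y)).
      by rewrite /Y (bigD1 (Ordinal k1n))//= lerDl sumr_ge0.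
    by rewrite mulrDl mul1r; have := mulr_ge0 K0 (Y0 xm); lra.
  move=> nk; have -> : k.+1 = n by apply/eqP; rewrite eqn_leq nk ltn_ord.
  apply: le_trans (uK y _) _; first by lra.
  have := ler_wpM2l K0 YE; rewrite /Y mulrDl mul1r => h.
  by have := Y0 xm; rewrite /Y; lra.
have uk (k : 'I_n) : `|u k xm| <= B k * M + eps * ((K + 1) * Y xm).
  have [||z zc uz] := hB k u c M.
  - by apply: jet_on_sub jc => //; exact: ltnW.
  - by move=> y yc; apply: uM; lra.
  have := @der_le_lipschitz R (u k) (u k.+1) ((K + 1) * Y xm) c (c + eps) _ _ z xm zc xmc.
  move=> /(_ _ _)/wrap[|y yc|h]; first by move=> y yc; apply: jc.
    exact: unext.
  have : `|u k xm| <= `|u k z| + `|u k xm - u k z|.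
    by rewrite -[X in `|X| <= _](subrKC (u k z)) ler_normD.
  by move: h; rewrite addrAC subrr add0r mulrC; lra.
have : Y xm <= (\sum_(k < n) B k) * M + n%:R * (eps * ((K + 1) * Y xm)).
  apply: le_trans (ler_sum _ (fun k _ => uk k)) _.
  by rewrite big_split/= -mulr_suml sumr_const card_ord mulr_natl.
have eq : eps * (2 * q) <= 1.
  by rewrite -ler_pdivlMr ?div1r; [rewrite ge_min lexx orbT|lra].
have : n%:R * (eps * ((K + 1) * Y xm)) <= 2^-1 * Y xm.
  rewrite !mulrA; apply: ler_wpM2r => //.
  have : n%:R * (K + 1) * eps <= q * eps by apply: ler_wpM2r; [exact: ltW|rewrite lerDl].
  by rewrite mulrAC [n%:R * eps]mulrC; lra.
move=> h1 h2; apply: le_trans (Ymax x xc) _; lra.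
Qed.

End Landau.

(** * The energy form, its Euler operator and its antiderivative *)

Section EnergyForm.
Context {R : realType}.
Implicit Types (u w : nat -> R -> R) (x y a b : R).

(** The binomial weights are chosen so that the Euler-Lagrange operator of this form is
    [helmholtz]. *)
Definition energy p u w x : R := \sum_(k < p.+1) 'C(p, k)%:R * (u k x * w k x).

(* [energy_prim p u w] is an antiderivative of [energy p u w] as long as
   [u] is annihilated by [(d^2/dt^2 - 1)^p]: integrate [u^(k) w^(k)] by parts
   [k] times. *)
Definition energy_prim p u w x : R :=
  \sum_(k < p.+1) 'C(p, k)%:R *
    \sum_(i < k) (-1) ^+ i * (u (k + i)%N x * w (k.-1 - i)%N x).

(** The binomial expansion of [(1 - d^2/dt^2)^p]. *)
Definition helmholtz p u x : R :=
  \sum_(k < p.+1) 'C(p, k)%:R * ((-1) ^+ k * u (2 * k)%N x).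

Lemma energy_primP p u w x :
  (forall k, (k < 2 * p)%N -> is_derive x 1 (u k) (u k.+1 x)) ->
  (forall k, (k < p)%N -> is_derive x 1 (w k) (w k.+1 x)) ->
  helmholtz p u x = 0 ->
  is_derive x 1 (energy_prim p u w) (energy p u w x).
Proof.
move=> du dw Lu.
have -> : energy p u w x = \sum_(k < p.+1) 'C(p, k)%:R *
    \sum_(i < k) (-1) ^+ i * (u (k + i).+1 x * w (k.-1 - i)%N x
                            + u (k + i)%N x * w (k.-1 - i).+1 x).
  (* Subtracting this zero term leaves [u^(k) w^(k) - (-1)^k u^(2k) w] for each [k], which
     telescopes into the derivatives of the boundary terms of [k] integrations by parts. *)
  transitivity (energy p u w x - helmholtz p u x * w 0%N x).
    by rewrite Lu mul0r subr0.
  rewrite /energy /helmholtz mulr_suml -sumrB; apply: eq_bigr => -[k /= kp] _.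
  rewrite -mulrA -mulrBr; congr (_ * _).
  pose t i := - ((-1) ^+ i * (u (k + i)%N x * w (k - i)%N x)).
  transitivity (t k - t 0%N).
    by rewrite /t addnn -mul2n subnn addn0 subn0 expr0 mul1r; ring.
  rewrite -(telescope_sumr t (leq0n k)) big_mkord; apply: eq_bigr => -[i /= ik] _.
  rewrite /t addnS exprS.
  have -> : (k.-1 - i).+1 = (k - i)%N by case: k ik {kp t} => // k ik; rewrite subSn.
  have -> : (k - i.+1 = k.-1 - i)%N by case: k ik {kp t}.
  ring.
apply: der_sum => -[k /= kp]; apply: derZ; apply: der_sum => -[i /= ik].
apply: derZ; apply: derM.
  by apply: du; rewrite mul2n -addnn; apply: (@leq_trans (k + k)%N); rewrite ?ltn_add2l ?leq_add.
apply: dw; apply: leq_ltn_trans (leq_subr _ _) _.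
by case: k ik kp.
Qed.

Lemma energy_ge_sq p u x k : (k <= p)%N -> u k x ^+ 2 <= energy p u u x.
Proof.
move=> kp; rewrite /energy (bigD1 (Ordinal (kp : (k < p.+1)%N)))//=.
have h : 1 <= 'C(p, k)%:R :> R by rewrite ler1n bin_gt0.
rewrite -expr2; apply: le_trans (_ : 'C(p, k)%:R * u k x ^+ 2 <= _).
  by rewrite ler_peMl ?sqr_ge0.
by rewrite lerDl sumr_ge0// => i _; rewrite mulr_ge0 ?ler0n// -expr2 sqr_ge0.
Qed.

Lemma energy_ge0 p u x : 0 <= energy p u u x.
Proof. exact: le_trans (sqr_ge0 _) (@energy_ge_sq p u x 0 (leq0n p)). Qed.

Lemma energy_CS p u w x : 2 * energy p u w x <= energy p u u x + energy p w w x.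
Proof.
rewrite /energy -big_split mulr_sumr; apply: ler_sum => i _ /=.
rewrite -mulrDr mulrCA ler_wpM2l//.
by have := sqr_ge0 (u i x - w i x); rewrite sqrrB; lra.
Qed.

Lemma energy_primB p u w v x :
  energy_prim p u (fun k y => w k y - v k y) x =
  energy_prim p u w x - energy_prim p u v x.
Proof.
rewrite /energy_prim -sumrB; apply: eq_bigr => k _; rewrite -mulrBr -sumrB.
by congr (_ * _); apply: eq_bigr => i _; ring.
Qed.

Lemma energy_prim_eq0 p u w x : (forall k, (k < p)%N -> w k x = 0) ->
  energy_prim p u w x = 0.
Proof.
move=> w0; rewrite /energy_prim big1// => -[k /= kp] _; rewrite big1 ?mulr0// => -[i /= ik] _.
rewrite w0 ?mulr0//; apply: leq_ltn_trans (leq_subr _ _) _.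
by case: k ik kp.
Qed.

(** The jet of [x |-> u 0 (- x)]; it transfers estimates near -oo to +oo. *)
Definition reflect_jet u : nat -> R -> R := fun k x => (-1) ^+ k * u k (- x).

(** In each product the two orders of differentiation add up to the odd number [2 * k - 1], hence
    the sign. *)
Lemma energy_prim_reflect p u x :
  energy_prim p (reflect_jet u) (reflect_jet u) x = - energy_prim p u u (- x).
Proof.
rewrite /energy_prim -sumrN; apply: eq_bigr => -[k /= kp] _.
rewrite -mulrN -sumrN; congr (_ * _); apply: eq_bigr => -[i /= ik] _.
rewrite /reflect_jet.
have E : (k + i + (k.-1 - i) = (k.-1).*2.+1)%N by move: ik; case: k {kp} => // k ik /=; lia.
have s : (-1) ^+ (k + i) * (-1) ^+ (k.-1 - i) = -1 :> R.
  by rewrite -exprD E exprS -mul2n mulnC exprM sqrr_sign mulr1.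
by rewrite mulrACA s; ring.
Qed.

Lemma helmholtz_reflect p u x :
  helmholtz p (reflect_jet u) x = helmholtz p u (- x).
Proof.
apply: eq_bigr => k _; congr (_ * (_ * _)).
by rewrite /reflect_jet mulnC exprM sqrr_sign mul1r.
Qed.

Lemma reflect_jetP u k x : is_derive (- x) 1 (u k) (u k.+1 (- x)) ->
  is_derive x 1 (reflect_jet u k) (reflect_jet u k.+1 x).
Proof.
move=> du; have h : is_derive (-1 * x + 0) 1 (u k) (u k.+1 (- x)) by rewrite addr0 mulN1r.
have := derZ ((-1) ^+ k) (der_comp_affine h).
rewrite mulrA -exprSr; congr is_derive; apply/funext => y.
by rewrite addr0 mulN1r.
Qed.

End EnergyForm.

(** * Compactly supported bumps of bounded energy *)

Section Bump.
Context {R : realType}.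
Implicit Types (x y a b : R).

Definition ramp x : R := Num.max 0 x.

Lemma ramp_pos x : 0 <= x -> ramp x = x.
Proof. by move=> x0; rewrite /ramp; exact/max_idPr. Qed.

Lemma ramp_neg x : x <= 0 -> ramp x = 0.
Proof. by move=> x0; rewrite /ramp; exact/max_idPl. Qed.

Lemma ramp_ge0 x : 0 <= ramp x.
Proof. by rewrite /ramp le_max lexx. Qed.

(** Both sides vanish for negative [y]. This keeps the derivatives of the bump in the form of a
    polynomial times a power of the ramp. *)
Lemma rampM n y : ramp y ^+ n.+1 * y = ramp y ^+ n.+2.
Proof.
have [y0|/ltW y0] := lerP 0 y; first by rewrite ramp_pos// -exprSr.
by rewrite ramp_neg// !exprS !mul0r.
Qed.

Lemma der_rampX n x :
  is_derive x 1 (fun y => ramp y ^+ n.+2) (n.+2%:R * ramp x ^+ n.+1).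
Proof.
have [x0|x0|->] := ltrgtP x 0.
- have -> : n.+2%:R * ramp x ^+ n.+1 = 0 by rewrite ramp_neg ?ltW// exprS mul0r mulr0.
  apply: (@der_local _ (fun=> 0) _ x 0 (x - 1) 0); first by lra.
  by move=> y /andP[_ y0]; rewrite ramp_neg ?expr0n// ltW.
- rewrite ramp_pos ?ltW//.
  apply: (@der_local _ (fun y => y ^+ n.+2) _ x _ 0 (x + 1)); first by lra.
    by move=> y /andP[y0 _]; rewrite ramp_pos// ltW.
  have := is_deriveX n.+2 (is_derive_id x 1).
  by rewrite /GRing.scale/= mulr1; congr is_derive; apply/funext => y; rewrite exprfctE.
(* At the corner, the difference quotient based at 0 is [ramp y ^+ n.+1], which is continuous and
   vanishes at 0. *)
- apply/is_derive1_caratheodory; exists (fun y => ramp y ^+ n.+1); split.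
  + by move=> y; rewrite (ramp_pos (lexx 0)) expr0n !subr0 rampM.
  + apply: (@continuous_comp _ _ _ ramp (fun y => y ^+ n.+1)); last exact: exprn_continuous.
    by apply: continuous_max; [exact: cst_continuous|exact: id].
  + by rewrite (ramp_pos (lexx 0)) !expr0n mulr0.
Qed.

(** A truncated power is smooth enough: with exponent [p + 2], at least two factors of the ramp
    survive [p] differentiations, so all derivatives up to order [p] vanish outside the support. *)
Lemma exists_bump p (rho : R) : 0 < rho -> exists phi : nat -> R -> R, exists K : R,
  [/\ jet_on p setT phi, phi 0%N 0 = 1,
      forall k x, (k <= p)%N -> rho <= `|x| -> phi k x = 0,
      0 <= K & forall x, energy p phi phi x <= K].
Proof.
move=> rho0.
have [q qE dqE] : exists2 q : {poly R}, (forall x, q.[x] = rho ^+ 2 - x ^+ 2) &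
    (forall x, q^`().[x] = - (2 * x)).
  exists ((rho ^+ 2)%:P - 'X^2) => x; rewrite ?derivB ?derivC ?derivXn !hornerE//.
  ring.
(* [phi k] is the [k]-th derivative of [c * ramp (rho^2 - x^2) ^+ (p + 2)]. *)
pose c := (rho ^+ 2) ^- p.+2.
pose Q := fix Q k : {poly R} := if k is k'.+1 then
  (Q k')^`() * q - ((p.+2 - k')%:R * 2)%:P * ('X * Q k') else c%:P.
pose phi k x := (Q k).[x] * ramp q.[x] ^+ (p.+2 - k).
have phi0 k x : (k <= p)%N -> rho <= `|x| -> phi k x = 0.
  move=> kp xrho; rewrite /phi ramp_neg.
    by rewrite (_ : (p.+2 - k = (p - k).+2)%N) ?exprS ?mul0r ?mulr0//; lia.
  rewrite qE subr_le0 -(real_normK (num_real x)) ler_sqr// nnegrE; lra.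
pose B := fun k : 'I_p.+1 => sval (poly_disk_bound (Q k) rho).
have phiK (k : 'I_p.+1) x : `|phi k x| <= `|B k| * (rho ^+ 2) ^+ (p.+2 - k).
  have [xr|xr] := lerP rho `|x|.
    rewrite phi0// ?normr0; last by rewrite -ltnS.
    by rewrite mulr_ge0// exprn_ge0// sqr_ge0.
  rewrite normrM ler_pM//.
    apply: le_trans (ler_norm _); apply: (svalP (poly_disk_bound (Q k) rho)).
    exact: ltW.
  rewrite normrX lerXn2r ?nnegrE ?sqr_ge0// ger0_norm; last exact: ramp_ge0.
  by rewrite /ramp ge_max sqr_ge0 qE gerBl sqr_ge0.
exists phi, (\sum_(k < p.+1) 'C(p, k)%:R * (`|B k| * (rho ^+ 2) ^+ (p.+2 - k)) ^+ 2).
split=> //.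
- move=> k x kp _.
  have -> : phi k.+1 x = (Q k)^`().[x] * ramp q.[x] ^+ (p.+2 - k) +
      (Q k).[x] * ((p.+2 - k)%:R * ramp q.[x] ^+ (p.+2 - k.+1) * q^`().[x]).
    rewrite /phi /= hornerD hornerN !hornerM hornerX hornerC dqE; have E : (p.+2 - k = (p - k.+1).+3)%N by lia.
    have E' : (p.+2 - k.+1 = (p - k.+1).+2)%N by lia.
    rewrite E E' -(rampM (p - k.+1).+1).
    by ring.
  have E : (p.+2 - k = (p - k.+1).+3)%N by lia.
  have E' : (p.+2 - k.+1 = (p - k.+1).+2)%N by lia.
  rewrite /phi E E'.
  have dramp := @is_derive1_comp _ (fun y => ramp y ^+ (p - k.+1).+3) (horner q) x _ _
    (der_rampX _ _) (is_derive_poly q x).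
  exact: (derM (is_derive_poly (Q k) x) dramp).
- rewrite /phi /= hornerC subn0 qE expr0n subr0 ramp_pos ?sqr_ge0// mulVf//.
  by rewrite expf_neq0// expf_neq0// gt_eqF.
- by rewrite sumr_ge0// => k _; rewrite mulr_ge0// sqr_ge0.
- move=> x; apply: ler_sum => k _; apply: ler_wpM2l => //.
  rewrite -expr2 -(real_normK (num_real (phi k x))) ler_sqr ?nnegrE//.
  by rewrite mulr_ge0// exprn_ge0// sqr_ge0.
Qed.

End Bump.

(** * Exponential decay of a spline outside its knots *)

Section Decay.
Context {R : realType}.
Implicit Types (u : nat -> R -> R) (x y a b T : R).

Lemma der_expR_scale c x : is_derive x 1 (fun y => expR (c * y)) (c * expR (c * x)).
Proof.
have h : is_derive (c * x + 0) 1 expR (expR (c * x)) by rewrite addr0; exact: is_derive_expR.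
by have := der_comp_affine h; congr is_derive; apply/funext => y; rewrite addr0.
Qed.

(** The function [v = e^(-x) h] has derivative [e^(-x) g], of size at most [C e^(-x/2)]; comparison
    with an antiderivative bounds [v], and multiplication by [e^x] bounds [h]. At rate 1 each use
    would cost a factor of [x]; the rate 1/2 is preserved. *)
Lemma decay_inhomogeneous (h g : R -> R) T C :
  (forall x, x <= T -> is_derive x 1 h (h x + g x)) ->
  (forall x, x <= T -> `|g x| <= C * expR (2^-1 * x)) ->
  exists C', forall x, x <= T -> `|h x| <= C' * expR (2^-1 * x).
Proof.
move=> dh gC; pose v x := expR (-1 * x) * h x.
have dv x : x <= T -> is_derive x 1 v (expR (-1 * x) * g x).
  move=> xT; have := derM (der_expR_scale (-1) x) (dh x xT).
  by congr is_derive; ring.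
pose G x := (- 2 * C) * expR (- 2^-1 * x).
have dG x : is_derive x 1 G (C * expR (- 2^-1 * x)).
  have := derZ (- 2 * C) (der_expR_scale (- 2^-1) x).
  by congr is_derive; field.
have split x : expR (- 2^-1 * x) = expR (-1 * x) * expR (2^-1 * x).
  by rewrite -expRD; congr expR; field.
have C0 : 0 <= C.
  have := gC T (lexx T); have := expR_gt0 (2^-1 * T); have := normr_ge0 (g T).
  by move=> g0 e0 ge; rewrite -(pmulr_lge0 _ e0); apply: le_trans g0 ge.
have vG x : x <= T -> `|expR (-1 * x) * g x| <= C * expR (- 2^-1 * x).
  move=> xT; rewrite split normrM ger0_norm ?expR_ge0// mulrCA.
  by rewrite ler_wpM2l ?expR_ge0// gC.
have vB x : x <= T -> `|v x| <= `|v T| + 2 * C * expR (- 2^-1 * x).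
  move=> xT; have GT : G T - G x <= 2 * C * expR (- 2^-1 * x).
    by rewrite /G; have := mulr_ge0 C0 (expR_ge0 (- 2^-1 * T)); lra.
  have h1 : v T - v x <= G T - G x.
    apply: (@der_le_le _ v _ G _ _ _ xT (fun y yx => dv y (proj2 (andP yx))) (fun y _ => dG y)).
    by move=> y /andP[_ yT]; apply: le_trans (ler_norm _) (vG y yT).
  have h2 : -1 * v T - -1 * v x <= G T - G x.
    apply: (@der_le_le _ (fun y => -1 * v y) _ G _ _ _ xT
      (fun y yx => derZ (-1) (dv y (proj2 (andP yx)))) (fun y _ => dG y)).
    move=> y /andP[_ yT]; rewrite (mulN1r (_ * g y)); apply: le_trans (ler_norm _) _.
    by rewrite normrN vG.
  rewrite ler_norml; have := ler_norm (v T); have := ler_norm (- v T); rewrite normrN.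
  by move=> n1 n2; apply/andP; split; lra.
exists (expR (2^-1 * T) * `|v T| + 2 * C) => x xT.
have -> : h x = expR x * v x by rewrite /v mulrA -expRD mulN1r subrr expR0 mul1r.
rewrite normrM ger0_norm ?expR_ge0//.
apply: le_trans (ler_wpM2l (expR_ge0 x) (vB x xT)) _.
have e2 : expR x = expR (2^-1 * x) * expR (2^-1 * x) by rewrite -expRD; congr expR; field.
have e1 : expR x * expR (- 2^-1 * x) = expR (2^-1 * x) by rewrite -expRD; congr expR; field.
rewrite mulrDr mulrCA e1 e2.
have h1 : expR (2^-1 * x) * `|v T| <= expR (2^-1 * T) * `|v T|.
  by apply: ler_wpM2r => //; rewrite ler_expR; lra.
have := ler_wpM2l (expR_ge0 (2^-1 * x)) h1; lra.
Qed.

Definition first_order_jet a u : nat -> R -> R := fun k x => u k.+1 x + a * u k x.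

Lemma jet_on_first_order n (A : set R) a u i : jet_on n A u ->
  jet_on (n - i) A (iter i (first_order_jet a) u).
Proof.
move=> ju; elim: i => [|i IHi]; first by rewrite subn0.
move=> k x ki Ax; apply: derD; last apply: derZ; apply: IHi => //; lia.
Qed.

Lemma iter_first_order_reflect a u i k x :
  iter i (first_order_jet (- a)) (reflect_jet u) k x =
  (-1) ^+ (k + i) * iter i (first_order_jet a) u k (- x).
Proof.
elim: i k x => [|i IHi] k x; first by rewrite addn0.
by rewrite !iterS /first_order_jet -/(first_order_jet (- a)) -/(first_order_jet a) !IHi addSn !addnS !exprS; ring.
Qed.

(** Put [h i = (d/dt - 1)^i u]. Then [h p = 0] and [h i] solves [y' = y + h (i + 1)], so decay
    descends from [h p] to [h 0] through [decay_inhomogeneous], for each derivative. *)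
Lemma jet_decay p u T : (0 < p)%N -> jet_on (2 * p) [set x | x < T] u ->
  (forall x, x < T -> iter p (first_order_jet (-1)) u 0 x = 0) ->
  forall S, S < T -> exists C, forall k x, (k <= 2 * p)%N -> x <= S ->
    `|u k x| <= C * expR (2^-1 * x).
Proof.
move=> p0 ju u0 S ST; set h := fun i => iter i (first_order_jet (-1)) u.
have jh i : jet_on (2 * p - i) [set x | x < T] (h i) by exact: jet_on_first_order.
suff main i : (i <= p)%N -> forall k, (k + (p - i) <= 2 * p)%N -> 
    exists C, forall x, x <= S -> `|h (p - i)%N k x| <= C * expR (2^-1 * x).
  have {}main (k : 'I_(2 * p).+1) :
      exists C, forall x, x <= S -> `|u k x| <= C * expR (2^-1 * x).
    by have := main p (leqnn p) k; rewrite subnn addn0; apply; rewrite -ltnS.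
  have {main}[C hC] : exists C : 'I_(2 * p).+1 -> R,
      forall (k : 'I_(2 * p).+1) x, x <= S -> `|u k x| <= C k * expR (2^-1 * x).
    exists (fun k => sval (cid (main k))) => k; exact: (svalP (cid (main k))).
  exists (\sum_k `|C k|) => k x k2p xS.
  apply: le_trans (hC (Ordinal (k2p : (k < (2 * p).+1)%N)) x xS) _.
  apply: ler_wpM2r; first exact: expR_ge0.
  apply: le_trans (ler_norm _) _.
  by rewrite (bigD1 (Ordinal (k2p : (k < (2 * p).+1)%N)))//= lerDl sumr_ge0.
elim: i => [_|i IHi ip].
  suff hp0 k : (k <= p)%N -> forall x, x < T -> h p k x = 0.
    move=> k; rewrite subn0 => kp; exists 0 => x xS.
    by rewrite hp0 ?normr0 ?mul0r//; [lia|lra].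
  elim: k => [_|k IHk kp] x xT; first exact: u0.
  have d1 : is_derive x 1 (h p k) (h p k.+1 x) by apply: jh => //; lia.
  have d0 : is_derive x 1 (h p k) 0.
    apply: (@der_local _ (fun=> 0) _ x 0 (x - 1) T); first by lra.
    by move=> y /andP[_ yT]; rewrite IHk//; lia.
  by rewrite -(@derive_val _ _ _ _ _ _ _ d1) (@derive_val _ _ _ _ _ _ _ d0).
have {}IHi : forall k, (k + (p - i) <= 2 * p)%N ->
    exists C, forall x, x <= S -> `|h (p - i.+1).+1 k x| <= C * expR (2^-1 * x).
  have -> : ((p - i.+1).+1 = p - i)%N by lia.
  by apply: IHi; exact: ltnW.
have step k : (k + (p - i) <= 2 * p)%N ->
    exists C, forall x, x <= S -> `|h (p - i.+1)%N k x| <= C * expR (2^-1 * x).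
  move=> ki; have [C hC] := IHi k ki.
  apply: (decay_inhomogeneous _ hC) => x xS.
  have -> : h (p - i.+1)%N k x + h (p - i.+1).+1 k x = h (p - i.+1)%N k.+1 x.
    by rewrite {2}/h /= /first_order_jet -/(h _); ring.
  by apply: jh => /=; [lia|lra].
(* Only the highest available order is missed by [step], as it cannot be differentiated again. There
   the derivative is read off from the definition of the next [h]. *)
move=> k kpi; have [ki|ki] := leqP (k + (p - i)) (2 * p); first exact: step.
case: k kpi ki => [|k] kpi ki; first by lia.
have [|C hC] := step k; first by lia.
have [|D hD] := IHi k; first by lia.
exists (D + C) => x xS; rewrite mulrDl.
have -> : h (p - i.+1)%N k.+1 x = h (p - i.+1).+1 k x + h (p - i.+1)%N k x.
  by rewrite {2}/h /= /first_order_jet -/(h _); ring.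
by apply: le_trans (ler_normD _ _) _; apply: lerD; [exact: hD|exact: hC].
Qed.

(* [energy_prim p u u] is nondecreasing and tends to [0] at [-oo]. *)
Lemma energy_prim_left_ge0 p u T : (0 < p)%N ->
  jet_on (2 * p) [set x | x < T] u ->
  (forall x, x < T -> iter p (first_order_jet (-1)) u 0 x = 0) ->
  (forall x, x < T -> helmholtz p u x = 0) ->
  forall x, x < T -> 0 <= energy_prim p u u x.
Proof.
move=> p0 ju u0 Lu x xT; have [C hC] := jet_decay p0 ju u0 xT.
have C0 : 0 <= C.
  have := hC 0%N x (leq0n _) (lexx x); have := expR_gt0 (2^-1 * x).
  by move=> e0 ge; rewrite -(pmulr_lge0 _ e0); exact: le_trans ge.
pose D : R := \sum_(k < p.+1) 'C(p, k)%:R * \sum_(i < k) (C * C).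
have D0 : 0 <= D.
  by apply: sumr_ge0 => k _; rewrite mulr_ge0// sumr_ge0// => i _; rewrite mulr_ge0.
have decay y : y <= x -> - (D * expR y) <= energy_prim p u u y.
  move=> yx; suff : `|energy_prim p u u y| <= D * expR y by rewrite ler_norml => /andP[].
  rewrite /D mulr_suml; apply: le_trans (ler_norm_sum _ _ _) _.
  apply: ler_sum => -[k /= kp] _; rewrite normrM ger0_norm// -mulrA ler_wpM2l//.
  rewrite mulr_suml; apply: le_trans (ler_norm_sum _ _ _) _.
  apply: ler_sum => -[i /= ik] _.
  rewrite normrM normrX normrN1 expr1n mul1r normrM.
  have -> : expR y = expR (2^-1 * y) * expR (2^-1 * y) by rewrite -expRD; congr expR; field.
  by rewrite mulrACA; apply: ler_pM => //; apply: hC => //; lia.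
have mono y : y <= x -> energy_prim p u u y <= energy_prim p u u x.
  move=> yx; apply: (der_ge0_le yx) => [z zx|z _]; last exact: energy_ge0.
  apply: energy_primP => [k kp|k kp|]; last by apply: Lu; lra.
    by apply: ju => //=; lra.
  by apply: ju => //=; [lia|lra].
rewrite leNgt; apply/negP => Gx; set g := energy_prim p u u x in Gx.
(* Since [- y * expR y <= 1], this choice gives [(D + 1) * expR y <= - g], while decay and
   monotonicity give [- g <= D * expR y]. *)
pose y := Num.min x (- ((D + 1) / - g)).
have yx : y <= x by rewrite ge_min lexx.
have g0 : 0 < - g by lra.
have D1 : 0 < (D + 1) / - g by rewrite divr_gt0//; lra.
have ey : expR y * ((D + 1) / - g) <= 1.
  have yD : (D + 1) / - g <= - y by rewrite lerNr ge_min lexx orbT.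
  apply: le_trans (ler_wpM2l (expR_ge0 y) yD) _.
  have : - y <= expR (- y) by apply: le_trans (expR_ge1Dx (- y)); lra.
  move=> h; apply: le_trans (ler_wpM2l (expR_ge0 y) h) _.
  by rewrite -expRD subrr expR0.
have := decay y yx; have := mono y yx; rewrite -/g => h1 h2.
have h3 : expR y * (D + 1) <= - g.
  by move: ey; rewrite mulrA ler_pdivrMr// mul1r.
by have := expR_gt0 y; have := mulrDr (expR y) D 1; lra.
Qed.

Lemma energy_prim_right_le0 p u T : (0 < p)%N ->
  jet_on (2 * p) [set x | T < x] u ->
  (forall x, T < x -> iter p (first_order_jet 1) u 0 x = 0) ->
  (forall x, T < x -> helmholtz p u x = 0) ->
  forall x, T < x -> energy_prim p u u x <= 0.
Proof.
move=> p0 ju u0 Lu x xT.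
have := @energy_prim_left_ge0 p (reflect_jet u) (- T) p0.
rewrite -[x]opprK -oppr_ge0 -energy_prim_reflect; apply.
- by move=> k y kp /= yT; apply: reflect_jetP; apply: ju => //=; lra.
- by move=> y yT; rewrite iter_first_order_reflect u0 ?mulr0//; lra.
- by move=> y yT; rewrite helmholtz_reflect Lu//; lra.
- lra.
Qed.

End Decay.

(** * Behaviour of the antiderivative of the energy across one knot *)

Section Knot.
Context {R : realType}.
Implicit Types (u w : nat -> R -> R) (x y z a b T B d l r : R).

Lemma continuous_dnbhs (f : R -> R) T : {for T, continuous f} -> f z @[z --> T^'] --> f T.
Proof. by move=> fT; apply: cvg_within_filter. Qed.

Lemma cvg0_bounded_mul (f g : R -> R) T B d : 0 < d ->
  (forall z, 0 < `|z - T| < d -> `|f z| <= B) ->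
  g z @[z --> T^'] --> 0 -> f z * g z @[z --> T^'] --> 0.
Proof.
move=> d0 fB /cvgrPdist_lt g0; apply/cvgrPdist_lt => e e0.
have B1 : 0 < `|B| + 1 by rewrite ltr_wpDl.
have eB : 0 < e / (`|B| + 1) by rewrite divr_gt0.
have gT := g0 _ eB; have nT := nbhs_dnbhs_neq T.
have dT : \forall z \near T^', `|T - z| < d by apply: nbhs_dnbhs; exact: nbhsx_ballx.
near=> z; have zT : z != T by near: z.
have zd : `|T - z| < d by near: z.
have gz : `|0 - g z| < e / (`|B| + 1) by near: z.
rewrite sub0r normrN normrM.
have fz : `|f z| <= `|B| + 1.
  apply: (@le_trans _ _ B); last by have := ler_norm B; lra.
  by apply: fB; rewrite normr_gt0 subr_eq0 zT/= distrC.
move: gz; rewrite sub0r normrN ltr_pdivlMr// mulrC; apply: le_lt_trans.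
exact: ler_wpM2r.
Unshelve. all: by end_near. Qed.

(* Only the term [u (2 * p - 1) * w 0] involves a derivative of [u] that may
   jump at the knot. *)
Lemma energy_prim_cvg p u w T B d : (0 < p)%N -> 0 < d ->
  (forall k, (k <= 2 * p - 2)%N -> {for T, continuous (u k)}) ->
  (forall k, (k < p)%N -> {for T, continuous (w k)}) ->
  w 0%N T = 0 -> (forall z, 0 < `|z - T| < d -> `|u (2 * p - 1)%N z| <= B) ->
  exists l : R, energy_prim p u w z @[z --> T^'] --> l.
Proof.
move=> p0 d0 cu cw w0 uB.
exists (\sum_(k < p.+1) 'C(p, k)%:R * \sum_(i < k) (-1) ^+ i *
  if (k + i <= 2 * p - 2)%N then u (k + i)%N T * w (k.-1 - i)%N T else 0).
apply: (cvg_big add_continuous) => -[k /= kp] _; apply: cvgM; first exact: cvg_cst.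
apply: (cvg_big add_continuous) => -[i /= ik] _; apply: cvgM; first exact: cvg_cst.
case: ifPn => [ki|]; first apply: cvgM.
- by apply: continuous_dnbhs; exact: cu.
- apply: continuous_dnbhs; apply: cw; lia.
rewrite -ltnNge => ki.
have -> : (k + i = 2 * p - 1)%N by lia.
have -> : (k.-1 - i = 0)%N by lia.
apply: (cvg0_bounded_mul d0 uB); rewrite -w0.
by apply: continuous_dnbhs; apply: cw.
Qed.

(** This replaces the passage to the limit at a knot by a comparison of two points on either side;
    the error 1 is the [+ 1] in the constant of [knot_drop]. *)
Lemma cvg_dnbhs_close (f : R -> R) T l x y : f z @[z --> T^'] --> l -> x < T -> T < y ->
  exists x' y', [/\ x <= x' < T, T < y' <= y & `|f x' - f y'| <= 1].
Proof.
move=> /cvgrPdist_lt/(_ 2^-1) []; first by rewrite invr_gt0.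
move=> d /= d0 hd xT Ty.
have hd' z : z != T -> `|z - T| < d -> `|l - f z| < 2^-1.
  by move=> zT zd; apply: hd => //=; rewrite distrC.
exists (Num.max x (T - d / 2)), (Num.min y (T + d / 2)); split.
- by rewrite le_max lexx gt_max xT/=; lra.
- by rewrite ge_min lexx lt_min Ty/=; lra.
set x' := Num.max _ _; set y' := Num.min _ _.
have x'T : T - d / 2 <= x' < T by rewrite le_max lexx orbT gt_max xT/=; lra.
have y'T : T < y' <= T + d / 2 by rewrite ge_min lexx orbT lt_min Ty/=; lra.
have /ltW hx : `|l - f x'| < 2^-1.
  by apply: hd'; [rewrite lt_eqF|rewrite ltr_norml]; lra.
have /ltW hy : `|l - f y'| < 2^-1.
  by apply: hd'; [rewrite gt_eqF|rewrite ltr_norml]; lra.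
have -> : f x' - f y' = (l - f y') - (l - f x') by ring.
by apply: le_trans (ler_normB _ _) _; lra.
Qed.

(** The leading coefficient is [(-1) ^+ p], so the equation can be solved for the derivative of
    order [2 * p]. This is the differential inequality required by [jet_bound]. *)
Lemma helmholtz_bound p u x : helmholtz p u x = 0 ->
  `|u (2 * p)%N x| <= (\sum_(k < p.+1) 'C(p, k)%:R) * \sum_(k < 2 * p) `|u k x|.
Proof.
rewrite /helmholtz big_ord_recr/= binn mul1r => /eqP; rewrite addr_eq0 => /eqP h.
have -> : `|u (2 * p)%N x| = `|(-1) ^+ p * u (2 * p)%N x| by rewrite normrM normrX normrN1 expr1n mul1r.
rewrite -normrN -h; apply: le_trans (ler_norm_sum _ _ _) _.
apply: (@le_trans _ _ (\sum_(k < p) 'C(p, k)%:R * \sum_(k < 2 * p) `|u k x|)).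
  apply: ler_sum => -[k /= kp] _; rewrite normrM ger0_norm// ler_wpM2l//.
  rewrite normrM normrX normrN1 expr1n mul1r.
  have k2 : (2 * k < 2 * p)%N by lia.
  by rewrite (bigD1 (Ordinal k2))//= lerDl sumr_ge0.
by rewrite big_ord_recr/= mulrDl -mulr_suml lerDl mulr_ge0// sumr_ge0.
Qed.

Definition punctured T r : set R := [set x | T - r <= x < T \/ T < x <= T + r].

Lemma jet_bounded_near_knot p u T r : 0 < r -> continuous (u 0%N) ->
  jet_on (2 * p) (punctured T (2 * r)) u ->
  (forall x, punctured T (2 * r) x -> helmholtz p u x = 0) ->
  exists B, forall k z, (k < 2 * p)%N -> 0 < `|z - T| < r -> `|u k z| <= B.
Proof.
move=> r0 cu ju Lu.
have [|C C0 hC] := @jet_bound R (2 * p) (\sum_(k < p.+1) 'C(p, k)%:R) r _ r0.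
  by rewrite sumr_ge0.
have [||c _ cmax] := @EVT_max R (fun z => `|u 0%N z|) (T - 2 * r) (T + 2 * r); first by lra.
  apply: continuous_subspaceT => z; apply: (@cvg_norm _ R); exact: cu.
exists (C * `|u 0%N c|) => k z kp zT.
have [zlt|zgt] : (T - r <= z < T) \/ (T < z <= T + r).
  by move: zT; case: (ger0P (z - T)) => ?; lra.
- apply: (hC u (z - r) z) => //; first by lra.
  + by apply: jet_on_sub ju => // y /= yz; left; lra.
  + by move=> y yz; apply: helmholtz_bound; apply: Lu; left; lra.
  + by move=> y yz; apply: cmax; rewrite in_itv/=; lra.
  + lra.
- apply: (hC u z (z + r)) => //; first by lra.
  + by apply: jet_on_sub ju => // y /= yz; right; lra.
  + by move=> y yz; apply: helmholtz_bound; apply: Lu; right; lra.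
  + by move=> y yz; apply: cmax; rewrite in_itv/=; lra.
  + lra.
Qed.

(* Test [u] against a bump carrying the value of [u] at the knot: by
   [energy_CS] the drop of [energy_prim p u u] across the knot is at most half
   of the energy next to the knot, up to a constant. *)
Lemma knot_drop p r : (1 < p)%N -> 0 < r -> exists2 K : R, 0 <= K &
  forall u T, (forall k, (k <= 2 * p - 2)%N -> continuous (u k)) ->
    jet_on (2 * p) (punctured T (2 * r)) u ->
    (forall x, punctured T (2 * r) x -> helmholtz p u x = 0) ->
    `|u 0%N T| <= 1 ->
    let G := energy_prim p u u in
    forall x y, T - r <= x < T -> T < y <= T + r ->
      (G (T + r) - G y) + (G x - G (T - r)) <= 2 * (G (T + r) - G (T - r) + K).
Proof.
move=> p1 r0; have [phi [K [jphi phi0 phi_supp K0 phiK]]] := @exists_bump R p r r0.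
exists (K * r + 1); first by rewrite addr_ge0// mulr_ge0// ltW.
move=> u T cu ju Lu u1 G x y xT yT.
pose psi k z := u 0%N T * phi k (1 * z + - T).
have dpsi k z : (k < p)%N -> is_derive z 1 (psi k) (psi k.+1 z).
  move=> kp; have := derZ (u 0%N T) (der_comp_affine (jphi k (1 * z + - T) kp I)).
  by rewrite mul1r.
have psi_supp k z : (k < p)%N -> r <= `|z - T| -> psi k z = 0.
  by move=> kp zr; rewrite /psi mul1r phi_supp ?mulr0//; exact: ltnW.
have psiK z : energy p psi psi z <= K.
  apply: le_trans (phiK (1 * z + - T)); apply: ler_sum => k _.
  apply: ler_wpM2l => //; rewrite /psi -!expr2 exprMn ler_piMl ?sqr_ge0//.
  by rewrite -(real_normK (num_real _)) expr_le1.
pose F := energy_prim p u psi.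
have dG z : punctured T (2 * r) z -> is_derive z 1 G (energy p u u z).
  by move=> zT; apply: energy_primP => [k kp|k kp|]; [exact: ju|apply: ju => //; lia|exact: Lu].
have dF z : punctured T (2 * r) z -> is_derive z 1 F (energy p u psi z).
  move=> zT; exact: (energy_primP (fun k kp => ju k z kp zT) (fun k kp => dpsi k z kp) (Lu z zT)).
(* This is [energy_CS] integrated over an interval of length at most [r], with the energy of [psi]
   bounded by [K]. *)
have incr a b : a <= b -> (T - r <= a /\ b < T) \/ (T < a /\ b <= T + r) ->
    F b - F a <= 2^-1 * (G b - G a) + 2^-1 * K * r /\ G a <= G b.
  move=> ab abT.
  have inT z : a <= z <= b -> punctured T (2 * r) z.
    by move=> zab; case: abT => abT; [left|right]; lra.
  split; last by apply: (der_ge0_le ab (fun z zab => dG z (inT z zab))) => z _; exact: energy_ge0.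
  have h := @der_le_le R F (energy p u psi)
    (fun z => 2^-1 * G z + 2^-1 * K * z)
    (fun z => 2^-1 * energy p u u z + 2^-1 * K * 1) a b ab
    (fun z zab => dF z (inT z zab))
    (fun z zab => derD (derZ 2^-1 (dG z (inT z zab))) (derZ (2^-1 * K) (is_derive_id z 1))).
  have {}h : F b - F a <= 2^-1 * G b + 2^-1 * K * b - (2^-1 * G a + 2^-1 * K * a).
    by apply: h => z _; have := energy_CS p u psi z; have := psiK z; lra.
  have br : b - a <= r by lra.
  by have := ler_wpM2l K0 br; lra.
have [B uB] := jet_bounded_near_knot r0 (cu 0%N (leq0n _)) ju Lu.
(* The difference [u - psi] vanishes at [T], so [G - F] has a two-sided limit there. *)
have [|||||l Hl] := @energy_prim_cvg p u (fun k z => u k z - psi k z) T B r _ r0.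
- lia.
- by move=> k kp; exact: cu.
- move=> k kp; apply: cvgB; first by apply: cu; lia.
  exact: (der_continuous (dpsi k T kp)).
- by rewrite /psi mul1r subrr phi0 mulr1 subrr.
- by move=> z zT; apply: uB => //; lia.
have [|| x' [y' [x'T y'T]]] := @cvg_dnbhs_close _ T l x y Hl; [lra|lra|].
rewrite !energy_primB -/F -/G => /ler_normlP[_ Hxy].
have Fl : F (T - r) = 0.
  by apply: energy_prim_eq0 => k kp; apply: psi_supp => //; rewrite addrAC subrr sub0r normrN ger0_norm// ltW.
have Fr : F (T + r) = 0.
  by apply: energy_prim_eq0 => k kp; apply: psi_supp => //; rewrite addrAC subrr add0r ger0_norm// ltW.
(* Let [E] be the increase of [G] on [[T - r, x']] plus that on [[y', T + r]]. As [F] vanishes at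
   [T - r] and [T + r], [F x' - F y' <= E / 2 + K * r], so [E <= G (T + r) - G (T - r) + 1 + E / 2 +
   K * r]; solve for [E]. Monotonicity then passes from [x'], [y'] to [x], [y]. *)
have [|| i1 _] := incr (T - r) x'; [lra|left; lra|].
have [|| i2 _] := incr y' (T + r); [lra|right; lra|].
have [|| _ m1] := incr x x'; [lra|left; lra|].
have [|| _ m2] := incr y' y; [lra|right; lra|].
lra.
Qed.

End Knot.

(** * Uniform bounds for real natural splines at frequency 1 *)

Section NaturalJet.
Context {R : realType}.
Implicit Types (u : nat -> R -> R) (x y z a b d r : R) (T : nat -> R).

Definition off_knots N T : set R := [set x | forall k, (k <= N)%N -> x != T k].

(* A real natural spline for [|xi| = 1], with its derivatives. *)
Definition natural_jet p N T u :=
  [/\ forall k, (k <= 2 * p - 2)%N -> continuous (u k),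
      jet_on (2 * p) (off_knots N T) u,
      forall x, off_knots N T x -> helmholtz p u x = 0,
      forall x, x < T 0%N -> iter p (first_order_jet (-1)) u 0%N x = 0 &
      forall x, T N < x -> iter p (first_order_jet 1) u 0%N x = 0].

(** Estimates use the knots only through such a lower bound on the gaps, so they stay uniform when
    the knots are rescaled. *)
Definition separated N d T := forall k, (k < N)%N -> T k + d <= T k.+1.

Lemma separated_lt N d T i j : 0 < d -> separated N d T -> (i < j <= N)%N ->
  T i + d <= T j.
Proof.
move=> d0 sT /andP[]; elim: j => // j IHj.
rewrite ltnS leq_eqVlt => /predU1P[-> jN|ij jN]; first exact: sT.
by have := IHj ij (ltnW jN); have := sT j jN; lra.
Qed.

Lemma off_left N d T x : 0 < d -> separated N d T -> x < T 0%N -> off_knots N T x.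
Proof.
move=> d0 sT x0 [|k] kN; first by rewrite lt_eqF.
have /(separated_lt d0 sT) h : (0 < k.+1 <= N)%N by [].
by rewrite lt_eqF//; lra.
Qed.

Lemma off_right N d T x : 0 < d -> separated N d T -> T N < x -> off_knots N T x.
Proof.
move=> d0 sT xN k; rewrite leq_eqVlt => /predU1P[->|kN]; first by rewrite gt_eqF.
have /(separated_lt d0 sT) h : (k < N <= N)%N by rewrite kN leqnn.
by rewrite gt_eqF//; lra.
Qed.

Lemma off_mid N d T x j : 0 < d -> separated N d T -> (j < N)%N ->
  T j < x < T j.+1 -> off_knots N T x.
Proof.
move=> d0 sT jN xj k kN; have [kj|kj|->] := ltngtP k j; last by rewrite gt_eqF; lra.
  have /(separated_lt d0 sT) h : (k < j <= N)%N by rewrite kj ltnW.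
  by rewrite gt_eqF//; lra.
rewrite lt_eqF//; have [->|jk] := eqVneq k j.+1; first by lra.
have /(separated_lt d0 sT) h : (j.+1 < k <= N)%N by lia.
lra.
Qed.

Lemma off_knotsP N T x : off_knots N T x ->
  [\/ x < T 0%N, T N < x | exists2 j, (j < N)%N & T j < x < T j.+1].
Proof.
move=> xoff; have [x0|x0] := ltP x (T 0%N); first by constructor 1.
have {x0}x0 : T 0%N < x by rewrite lt_neqAle eq_sym x0 xoff.
suff h n : (n <= N)%N -> T n < x \/ exists2 j, (j < n)%N & T j < x < T j.+1.
  by have [|[j jN xj]] := h N (leqnn N); [constructor 2|constructor 3; exists j].
elim: n => [_|n IHn nN]; first by left.
have [xn|[j jn xj]] := IHn (ltnW nN); last by right; exists j => //; exact: ltnW.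
have [xn1|] := ltP x (T n.+1); first by right; exists n => //; rewrite xn.
by left; rewrite lt_neqAle eq_sym xoff.
Qed.

(** A window of the same length at every point keeps the constants independent of the point. Between
    two knots it goes to the left of [x] if there is room, and otherwise to the right, where it ends
    before [T j + 5 * r / 2]. *)
Lemma off_interval N d T x r : 0 < r -> 3 * r < d -> separated N d T -> off_knots N T x ->
  exists2 a, a <= x <= a + r & forall z, a <= z <= a + r -> off_knots N T z.
Proof.
move=> r0 rd sT; have d0 : 0 < d by lra.
move=> /off_knotsP[x0|xN|[j jN xj]].
- by exists (x - r) => [|z zx]; [lra|apply: (off_left d0 sT); lra].
- by exists x => [|z zx]; [lra|apply: (off_right d0 sT); lra].
have Tj := sT j jN; have [xr|xr] := ltP (x - r) (T j + r / 2).
- by exists x => [|z zx]; [lra|apply: (off_mid d0 sT jN); lra].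
- by exists (x - r) => [|z zx]; [lra|apply: (off_mid d0 sT jN); lra].
Qed.

Lemma off_punctured N d T j r : 0 < d -> r < d -> separated N d T -> (j <= N)%N ->
  punctured (T j) r `<=` off_knots N T.
Proof.
move=> d0 rd sT jN x xj k kN; have [kj|kj|->] := ltngtP k j.
- have /(separated_lt d0 sT) h : (k < j <= N)%N by rewrite kj.
  by rewrite gt_eqF//; case: xj; lra.
- have /(separated_lt d0 sT) h : (j < k <= N)%N by rewrite kj.
  by rewrite lt_eqF//; case: xj; lra.
- by case: xj => xj; [rewrite lt_eqF|rewrite gt_eqF]; lra.
Qed.

(* [energy_prim p u u] starts nonnegative, ends nonpositive, increases between
   the knots and drops by at most [K] across a neighbourhood of each knot. *)
Lemma energy_prim_bound p N d : (1 < p)%N -> 0 < d -> exists2 M : R, 0 <= M &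
  forall T u, separated N d T -> natural_jet p N T u ->
    (forall k, (k <= N)%N -> `|u 0%N (T k)| <= 1) ->
    forall x, off_knots N T x -> `|energy_prim p u u x| <= M.
Proof.
move=> p1 d0; pose r := d / 4; have r0 : 0 < r by rewrite divr_gt0.
have rE : d = 4 * r by rewrite /r; field.
have [K K0 drop] := knot_drop p1 r0.
pose A := (N%:R + 1) * K; have A0 : 0 <= A by rewrite mulr_ge0// addr_ge0.
(* [A] bounds [|G|] at the points [T j - r] and [T j + r]. Closer to the knot, [drop] adds at most
   [2 * (2 * A + K)]. *)
exists (5 * A + 2 * K); first by lra.
move=> T u sT [cu ju Lu lu ru] uT; set G := energy_prim p u u.
have {}drop j x y : (j <= N)%N -> T j - r <= x < T j -> T j < y <= T j + r ->
    (G (T j + r) - G y) + (G x - G (T j - r)) <= 2 * (G (T j + r) - G (T j - r) + K).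
  move=> jN; have pj : punctured (T j) (2 * r) `<=` off_knots N T.
    by apply: (off_punctured d0 _ sT jN); lra.
  apply: drop => //; last exact: uT.
    exact: jet_on_sub ju.
  by move=> z /pj; exact: Lu.
have mono a b : a <= b -> (forall z, a <= z <= b -> off_knots N T z) -> G a <= G b.
  move=> ab ab_off; apply: (@der_ge0_le _ G (energy p u u) _ _ ab) => [z zab|z _]; last exact: energy_ge0.
  apply: energy_primP => [k kp|k kp|]; [apply: ju => //|apply: ju => //|apply: Lu]; try exact: ab_off.
  lia.
have p0 : (0 < p)%N by exact: ltnW.
have left_ge0 x : x < T 0%N -> 0 <= G x.
  apply: energy_prim_left_ge0 => //.
    by apply: jet_on_sub ju => // z /=; exact: (off_left d0 sT).
  by move=> z zT; apply: Lu; exact: (off_left d0 sT).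
have right_le0 x : T N < x -> G x <= 0.
  apply: energy_prim_right_le0 => //.
    by apply: jet_on_sub ju => // z /=; exact: (off_right d0 sT).
  by move=> z zT; apply: Lu; exact: (off_right d0 sT).
have cross j : (j <= N)%N -> G (T j - r) - K <= G (T j + r).
  by move=> jN; have := @drop j (T j - r) (T j + r) jN; lra.
have between j : (j < N)%N -> G (T j + r) <= G (T j.+1 - r).
  move=> jN; have := sT j jN => Tj; apply: mono; first by lra.
  by move=> z zj; apply: (off_mid d0 sT jN); lra.
(* Knots are counted from the left end, where [G] is nonnegative, and for [upper] from the right
   end, where [G] is nonpositive; each crossing costs at most [K]. *)
have lower j : (j <= N)%N -> - (j%:R * K) <= G (T j - r).
  elim: j => [_|j IHj jN]; first by rewrite mul0r oppr0 left_ge0//; lra.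
  have := IHj (ltnW jN); have := cross j (ltnW jN); have := between j jN.
  by rewrite -natr1 mulrDl; lra.
have upper j : (j <= N)%N -> G (T (N - j)%N + r) <= j%:R * K.
  elim: j => [_|j IHj jN]; first by rewrite mul0r subn0 right_le0//; lra.
  have E : (N - j = (N - j.+1).+1)%N by lia.
  have := IHj (ltnW jN); rewrite E.
  have := cross (N - j.+1).+1; have := between (N - j.+1)%N.
  move=> /(_ _)/wrap[|h1 /(_ _)/wrap[|h2]]; [lia|lia|].
  by rewrite -natr1 mulrDl; lra.
have natK (m : nat) : (m <= N)%N -> m%:R * K + K <= A.
  by move=> mN; rewrite /A mulrDl mul1r lerD2r ler_wpM2r// ler_nat.
have AL j : (j <= N)%N -> - A <= G (T j - r) /\ - A <= G (T j + r).
  by move=> jN; have := lower j jN; have := cross j jN; have := natK j jN; lra.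
have AU j : (j <= N)%N -> G (T j - r) <= A /\ G (T j + r) <= A.
  move=> jN; have := upper (N - j)%N (leq_subr _ _); rewrite subKn//.
  by have := cross j jN; have := natK (N - j)%N (leq_subr _ _); lra.
have right_of j y : (j <= N)%N -> T j < y <= T j + r -> - (5 * A + 2 * K) <= G y.
  move=> jN yj; have := @drop j (T j - r) y jN; have := AL j jN; have := AU j jN.
  by move=> ? ? /(_ _ _)/wrap[|| ?]; lra.
have left_of j x : (j <= N)%N -> T j - r <= x < T j -> G x <= 5 * A + 2 * K.
  move=> jN xj; have := @drop j x (T j + r) jN; have := AL j jN; have := AU j jN.
  by move=> ? ? /(_ _ _)/wrap[|| ?]; lra.
move=> x xoff; rewrite ler_norml.
have [x0|xN|[j jN xj]] := off_knotsP xoff.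
- have := left_ge0 x x0; have [xr|xr] := lerP (T 0%N - r) x.
    by have := @left_of 0%N x (leq0n N); move=> /(_ _)/wrap[|? ?]; lra.
  have := AU 0%N (leq0n _); have : G x <= G (T 0%N - r).
    by apply: mono; [lra|move=> z zx; apply: (off_left d0 sT); lra].
  by lra.
- have := right_le0 x xN; have [xr|xr] := lerP x (T N + r).
    by have := @right_of N x (leqnn N); move=> /(_ _)/wrap[|? ?]; lra.
  have := AL N (leqnn _); have : G (T N + r) <= G x.
    by apply: mono; [lra|move=> z zx; apply: (off_right d0 sT); lra].
  by lra.
- apply/andP; split.
    have [xr|xr] := lerP x (T j + r).
      by apply: (right_of j x (ltnW jN)); lra.
    have := AL j (ltnW jN); have : G (T j + r) <= G x.
      by apply: mono; [lra|move=> z zx; apply: (off_mid d0 sT jN); lra].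
    by lra.
  have [xr|xr] := lerP (T j.+1 - r) x.
    by apply: (left_of j.+1 x jN); lra.
  have := AU j.+1 jN; have : G x <= G (T j.+1 - r).
    by apply: mono; [lra|move=> z zx; apply: (off_mid d0 sT jN); lra].
  by lra.
Qed.

Lemma sq_le_norm_le x a : x ^+ 2 <= a -> `|x| <= a + 1.
Proof.
move=> xa; rewrite -(real_normK (num_real x)) in xa.
have := sqr_ge0 (`|x| - 1); have := sqr_ge0 `|x|; rewrite sqrrB; lra.
Qed.

(** On a window of length [r] off the knots the energy integrates to at most [2 * M]. Hence
    [u^2 <= 2 * M / r] at some point of it, and [u^2] varies by at most [2 * M] from there, which
    gives [u^2 <= Q]. The derivatives follow by [jet_bound]. *)
Lemma natural_jet_bound p N d : (1 < p)%N -> 0 < d -> exists2 C : R, 0 <= C &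
  forall T u, separated N d T -> natural_jet p N T u ->
    (forall k, (k <= N)%N -> `|u 0%N (T k)| <= 1) ->
    forall k x, (k <= 2 * p - 2)%N -> `|u k x| <= C.
Proof.
move=> p1 d0; pose r := d / 4; have r0 : 0 < r by rewrite divr_gt0.
have rE : d = 4 * r by rewrite /r; field.
have [M M0 GM] := energy_prim_bound N p1 d0.
have [|D D0 hD] := @jet_bound R (2 * p) (\sum_(k < p.+1) 'C(p, k)%:R) r _ r0.
  by rewrite sumr_ge0.
pose Q := 2 * M / r + 2 * M; have Q0 : 0 <= Q by rewrite addr_ge0 ?divr_ge0 ?mulr_ge0// ltW.
exists (D * (Q + 1)); first by rewrite mulr_ge0// addr_ge0.
move=> T u sT nu uT; have {}GM := GM T u sT nu uT.
case: nu => [cu ju Lu _ _].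
have rd : 3 * r < d by lra.
have dG z : off_knots N T z -> is_derive z 1 (energy_prim p u u) (energy p u u z).
  move=> zoff; apply: energy_primP => [k kp|k kp|]; [exact: ju|apply: ju => //|exact: Lu].
  lia.
have u0Q x : off_knots N T x -> `|u 0%N x| <= Q + 1.
  move=> xoff; have [a xa aoff] := off_interval r0 rd sT xoff.
  apply: sq_le_norm_le.
  have ar : a < a + r by lra.
  have [z za] := mean_value ar (fun z zar => dG z (aoff z zar)).
  rewrite addrAC subrr add0r => GE.
  have G_incr b c : a <= b <= a + r -> a <= c <= a + r ->
      energy_prim p u u c - energy_prim p u u b <= 2 * M.
    move=> ba ca; have := GM b (aoff b ba); have := GM c (aoff c ca).
    by rewrite !ler_norml; lra.
  have ez : u 0%N z ^+ 2 <= 2 * M / r.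
    apply: le_trans (@energy_ge_sq R p u z 0 _) _ => //.
    by rewrite ler_pdivlMr// -GE; apply: G_incr; lra.
  (* The terms of order 0 and 1 have weights 1 and [p >= 1], so the energy dominates
     [u^2 + u'^2]. *)
  have e01 y : 2 * `|u 0%N y * u 1%N y| <= energy p u u y.
    have p10 : (0 < p)%N by exact: ltnW.
    rewrite /energy (bigD1 ord0)//= (bigD1 (Ordinal (p10 : (1 < p.+1)%N)))//= bin0 bin1 mul1r.
    have pR : 1 <= p%:R :> R by rewrite ler1n.
    have h : 0 <= \sum_(i < p.+1 | (i != ord0) && (i != Ordinal (p10 : (1 < p.+1)%N)))
        'C(p, i)%:R * (u i y * u i y).
      by apply: sumr_ge0 => i _; rewrite mulr_ge0// -expr2 sqr_ge0.
    have h1 : u 1%N y * u 1%N y <= p%:R * (u 1%N y * u 1%N y) by rewrite ler_peMl// -expr2 sqr_ge0.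
    have := sqr_ge0 (`|u 0%N y| - `|u 1%N y|); rewrite sqrrB !real_normK ?num_real// normrM.
    rewrite -!expr2 in h1 *; lra.
  have dS y : off_knots N T y ->
      is_derive y 1 (fun z => u 0%N z * u 0%N z) (u 1%N y * u 0%N y + u 0%N y * u 1%N y).
    move=> yoff; have p20 : (0 < 2 * p)%N by rewrite muln_gt0/=; exact: ltnW.
    exact: (derM (ju 0%N y p20 yoff) (ju 0%N y p20 yoff)).
  have e01N y : - (u 0%N y * u 1%N y) * 2 <= energy p u u y.
    by apply: le_trans (e01 y); rewrite mulrC ler_pM2l// -normrN ler_norm.
  have e01P y : u 0%N y * u 1%N y * 2 <= energy p u u y.
    by apply: le_trans (e01 y); rewrite mulrC ler_pM2l// ler_norm.
  have [xz|/ltW zx] := lerP x z.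
    have yoff y : x <= y <= z -> off_knots N T y by move=> yxz; apply: aoff; lra.
    have := @der_le_le _ (fun y => -1 * (u 0%N y * u 0%N y)) _ _ _ _ _ xz
      (fun y yxz => derZ (-1) (dS y (yoff y yxz))) (fun y yxz => dG y (yoff y yxz)).
    move=> /(_ _)/wrap[y yxz|]; first by have := e01N y; lra.
    by have := G_incr x z; rewrite /Q !expr2 in ez *; lra.
  have yoff y : z <= y <= x -> off_knots N T y by move=> yxz; apply: aoff; lra.
  have := @der_le_le _ _ _ _ _ _ _ zx
    (fun y yxz => dS y (yoff y yxz)) (fun y yxz => dG y (yoff y yxz)).
  move=> /(_ _)/wrap[y yxz|]; first by have := e01P y; lra.
  by have := G_incr z x; rewrite /Q !expr2 in ez *; lra.
have ukQ k x : (k < 2 * p)%N -> off_knots N T x -> `|u k x| <= D * (Q + 1).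
  move=> kp xoff; have [a xa aoff] := off_interval r0 rd sT xoff.
  apply: (hD u a (a + r)) => //; first by lra.
  - by apply: jet_on_sub ju => // z /=; exact: aoff.
  - by move=> y ya; apply: helmholtz_bound; apply: Lu; exact: aoff.
  - by move=> y ya; apply: u0Q; exact: aoff.
move=> k x kp; have kp2 : (k < 2 * p)%N by lia.
have [xoff|] := pselect (off_knots N T x); first exact: ukQ.
move=> /existsNP[j /not_implyP[jN /negP/negPn/eqP ->]].
(* Up to order [2 * p - 2] the derivatives are continuous, so the bound extends to the knot
   itself. *)
apply: cvgr_to_le (cvg_norm (continuous_dnbhs (cu k kp (T j)))) _.
near=> z; apply: ukQ => //; apply: (@off_punctured N d T j r) => //; first by lra.
have zT : z != T j by near: z; exact: nbhs_dnbhs_neq.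
have : `|T j - z| < r by near: z; apply: nbhs_dnbhs; exact: nbhsx_ballx.
rewrite ltr_norml /punctured/=; move: zT; rewrite neq_lt => /orP[zT|zT] zr; [left|right]; lra.
Unshelve. all: by end_near. Qed.

End NaturalJet.

(** * Rescaling of real splines to frequency 1 *)

Section RealSpline.
Context {R : realType}.
Implicit Types (f g : R -> R) (u v : nat -> R -> R) (x y a c r : R) (A : set R).

Definition derivatives f : nat -> R -> R := fun k => f^`(k).

Lemma derivatives_jet n A f :
  (forall i x, (i < n)%N -> A x -> derivable f^`(i) x 1) -> jet_on n A (derivatives f).
Proof.
move=> df k x kn Ax; apply: DeriveDef; first exact: df.
by rewrite /derivatives derive1nS derive1E.
Qed.

(** The jet of [x |-> u 0 (x / r)], which turns the frequency [r] into 1. *)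
Definition rescale r u : nat -> R -> R := fun k x => r ^- k * u k (r^-1 * x).

Lemma jet_on_rescale n A r u : jet_on n A u ->
  jet_on n [set x | A (r^-1 * x)] (rescale r u).
Proof.
move=> ju k x kn Ax; have := ju k (r^-1 * x) kn Ax; rewrite -[r^-1 * x]addr0 => h.
have := derZ (r ^- k) (der_comp_affine h).
rewrite mulrA -invfM -exprSr addr0; congr is_derive.
by apply/funext => y; rewrite addr0.
Qed.

Definition second_order_jet c u : nat -> R -> R := fun k x => u k.+2 x - c * u k x.

Lemma iter_first_order_rescale r a u i k x : r != 0 ->
  iter i (first_order_jet a) (rescale r u) k x =
  r ^- (k + i) * iter i (first_order_jet (a * r)) u k (r^-1 * x).
Proof.
move=> r0; elim: i k x => [|i IHi] k x; first by rewrite addn0.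
rewrite !iterS /first_order_jet -!/(first_order_jet _) !IHi addSn addnS exprS.
by field; rewrite r0 expf_neq0.
Qed.

Lemma iter_second_order_rescale r c u i k x : r != 0 ->
  iter i (second_order_jet c) (rescale r u) k x =
  r ^- (k + 2 * i) * iter i (second_order_jet (c * r ^+ 2)) u k (r^-1 * x).
Proof.
move=> r0; elim: i k x => [|i IHi] k x; first by rewrite muln0 addn0.
rewrite !iterS /second_order_jet -!/(second_order_jet _) !IHi mulnS addnA addn2 !addSn !exprS.
by field; rewrite r0 expf_neq0.
Qed.

Lemma jet_on_second_order n A c u i : jet_on n A u ->
  jet_on (n - 2 * i) A (iter i (second_order_jet c) u).
Proof.
move=> ju; elim: i => [|i IHi]; first by rewrite muln0 subn0.
move=> k x ki Ax; have h1 := IHi k.+2 x; have h2 := IHi k x.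
have := derD (h1 _ Ax) (derZ (- c) (h2 _ Ax)).
move=> /(_ _ _)/wrap[||]; [lia|lia|].
rewrite /= /second_order_jet mulNr; congr is_derive.
by apply/funext => y; rewrite mulNr.
Qed.

(** The binomial theorem for the operators, by induction on [p] with Pascal's rule. The shift [j] in
    [S] is needed because [second_order_jet] reads the previous iterate at the orders [j] and
    [j + 2]. *)
Lemma helmholtzE p u x :
  helmholtz p u x = (-1) ^+ p * iter p (second_order_jet 1) u 0%N x.
Proof.
pose S p j := \sum_(k < p.+1) 'C(p, k)%:R * ((-1) ^+ k * u (2 * k + j)%N x).
suff SE j : (-1) ^+ p * iter p (second_order_jet 1) u j x = S p j.
  by rewrite SE; apply: eq_bigr => k _; rewrite addn0.
elim: p j => [|p IHp] j.
  by rewrite /S big_ord_recl big_ord0 bin0 expr0 /= !mul1r addr0.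
rewrite iterS {1}/second_order_jet exprS mul1r.
have -> : -1 * (-1) ^+ p * (iter p (second_order_jet 1) u j.+2 x - iter p (second_order_jet 1) u j x)
  = S p j - S p j.+2 by rewrite -!IHp; ring.
rewrite {3}/S big_ord_recl.
under [X in _ = _ + X]eq_bigr => k _ do
  rewrite /= /bump /= add1n binS natrD mulrDl exprS mulN1r mulNr mulrN [_ * - _]mulrN.
rewrite big_split/= !sumrN addrA; congr (_ - _); last first.
  by apply: eq_bigr => k _; rewrite mulnS [(2 + _)%N]addnC -addnA.
rewrite /S big_ord_recl/= !bin0; congr (_ + _).
rewrite [X in _ = - X]big_ord_recr/= bin_small// mul0r addr0 -sumrN.
by apply: eq_bigr => k _; rewrite /bump/= add1n exprS mulN1r mulNr mulrN.
Qed.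

Lemma derive1n_local A f g (dg : R -> R) x : (\forall y \near x, A y) -> A x ->
  (forall y, A y -> f y = g y) -> is_derive x 1 g (dg x) -> f^`() x = dg x.
Proof.
move=> nA Ax fg dgx; rewrite derive1E.
have -> : 'D_1 f x = 'D_1 g x.
  by apply: near_eq_derive; apply: filterS nA => y Ay; exact: fg.
exact: derive_val.
Qed.

(** The left side differentiates the whole function anew at each step; the right side only
    recombines derivatives of [f]. As [A] is open, an equality on [A] can be differentiated, as long
    as the derivatives involved exist. *)
Lemma iter_first_order_jet n A a f i x : (forall x, A x -> \forall y \near x, A y) ->
  jet_on n A (derivatives f) -> (i <= n)%N -> A x ->
  iter i (fun g y => derive1n 1 g y + a * g y) f x =
  iter i (first_order_jet a) (derivatives f) 0%N x.
Proof.
move=> nA jf; elim: i x => [//|i IHi] x iN Ax.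
rewrite !iterS [RHS]/first_order_jet IHi// ?(ltnW iN)//; congr (_ + _).
have iN0 : (0 < n - i)%N by lia.
rewrite derive1n1; apply: (derive1n_local (nA x Ax) Ax (fun y => IHi y (ltnW iN))).
exact: (@jet_on_first_order _ n A a _ i jf 0%N x iN0 Ax).
Qed.

Lemma iter_second_order_jet n A c f i x : (forall x, A x -> \forall y \near x, A y) ->
  jet_on n A (derivatives f) -> (2 * i <= n)%N -> A x ->
  iter i (fun g y => derive1n 2 g y - c * g y) f x =
  iter i (second_order_jet c) (derivatives f) 0%N x.
Proof.
move=> nA jf; elim: i x => [//|i IHi] x iN Ax.
have iN' : (2 * i <= n)%N by lia.
have iN0 : (0 < n - 2 * i)%N by lia.
have iN1 : (1 < n - 2 * i)%N by lia.
rewrite !iterS [RHS]/second_order_jet IHi//; congr (_ - _).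
rewrite derive1nS derive1n1; set g := iter i _ f.
have g1 y : A y -> g^`() y = iter i (second_order_jet c) (derivatives f) 1%N y.
  move=> Ay; apply: (derive1n_local (nA y Ay) Ay (fun z => IHi z iN')).
  exact: (@jet_on_second_order n A c _ i jf 0%N y iN0 Ay).
apply: (derive1n_local (nA x Ax) Ax g1).
exact: (@jet_on_second_order n A c _ i jf 1%N x iN1 Ax).
Qed.

(** What [natural_spline] says of the real and of the imaginary part: the operators have real
    coefficients and act on each separately. *)
Variant real_natural_spline p N (t : 'I_N.+1 -> R) r f : Prop :=
  RealNaturalSpline of
    (forall i x, (i < 2 * p - 2)%N -> derivable f^`(i) x 1) &
    continuous f^`(2 * p - 2) &
    (forall (j : 'I_N.+2) i x, (i < 2 * p)%N -> piece t j x -> derivable f^`(i) x 1) &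
    (forall (j : 'I_N.+2) x, piece t j x ->
      iter p (fun g y => derive1n 2 g y - r ^+ 2 * g y) f x = 0) &
    (forall x, x < t ord0 -> iter p (fun g y => derive1n 1 g y + - r * g y) f x = 0) &
    (forall x, t ord_max < x -> iter p (fun g y => derive1n 1 g y + r * g y) f x = 0).

Lemma xknotS N (t : 'I_N.+1 -> R) k : (k <= N)%N -> xknot t k.+1 = (t (inord k))%:E.
Proof.
move=> kN; rewrite /xknot; case: insubP => [i _ ik|]; last by rewrite ltnS kN.
by congr (t _)%:E; apply: val_inj; rewrite /= inordK.
Qed.

Lemma xknot_last N (t : 'I_N.+1 -> R) : xknot t N.+2 = +oo%E.
Proof. by rewrite /xknot insubF// ltnn. Qed.

Lemma near_piece N (t : 'I_N.+1 -> R) j x : piece t j x -> \forall y \near x, piece t j y.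
Proof.
rewrite /piece; move: (xknot t j) (xknot t j.+1) => lo hi [lox xhi].
have x1 : x - 1 < x < x + 1 by lra.
have nlo : \forall y \near x, (lo < y%:E)%E.
  case: lo lox => [l|//|_]; last by apply: filterS (near_lt_gt x1) => y _; rewrite ltNyr.
  rewrite lte_fin => lx; have lx1 : l < x < x + 1 by rewrite lx/=; lra.
  by apply: filterS (near_lt_gt lx1) => y /andP[ly _]; rewrite lte_fin.
have nhi : \forall y \near x, (y%:E < hi)%E.
  case: hi xhi => [h|_|//]; last by apply: filterS (near_lt_gt x1) => y _; rewrite ltry.
  rewrite lte_fin => xh; have xh1 : x - 1 < x < h by rewrite xh andbT; lra.
  by apply: filterS (near_lt_gt xh1) => y /andP[_ yh]; rewrite lte_fin.
exact: filterI.
Qed.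

Lemma off_knots_piece N (t : 'I_N.+1 -> R) x :
  off_knots N (fun k => t (inord k)) x -> exists j : 'I_N.+2, piece t j x.
Proof.
move=> /off_knotsP[x0|xN|[j jN /andP[jx xj]]].
- exists ord0; split; first exact: ltNyr.
  by rewrite xknotS// lte_fin.
- exists ord_max; split; first by rewrite xknotS// lte_fin.
  by rewrite xknot_last ltry.
(* The gap after knot [j] is the piece of index [j.+1], because [xknot] is shifted by one. *)
- have j1 : (j.+1 < N.+2)%N by lia.
  by exists (Ordinal j1); split; rewrite xknotS ?lte_fin//; exact: ltnW.
Qed.

Lemma natural_jet_rescale p N (t : 'I_N.+1 -> R) r f : (0 < p)%N -> 0 < r ->
  real_natural_spline p t r f ->
  natural_jet p N (fun k => r * t (inord k)) (rescale r (derivatives f)).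
Proof.
move=> p0 r0 [df cf dpf Lf lf rf]; have rN0 : r != 0 by rewrite gt_eqF.
have inord0 : inord 0 = ord0 :> 'I_N.+1 by apply: val_inj; rewrite /= inordK.
have inordN : inord N = ord_max :> 'I_N.+1 by apply: val_inj; rewrite /= inordK.
have scaleK x : r * (r^-1 * x) = x by rewrite mulVKf.
have off x : off_knots N (fun k => r * t (inord k)) x ->
    exists j : 'I_N.+2, piece t j (r^-1 * x).
  move=> xoff; apply: off_knots_piece => k kN; apply: contraNN (xoff k kN).
  by move=> /eqP <-; rewrite scaleK.
have jpf (j : 'I_N.+2) : jet_on (2 * p) (piece t j) (derivatives f).
  by apply: derivatives_jet => i x; exact: dpf.
have left_piece x : x < t ord0 -> piece t (ord0 : 'I_N.+2) x.
  move=> xt; split; first exact: ltNyr.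
  by rewrite xknotS// inord0 lte_fin.
have right_piece x : t ord_max < x -> piece t (ord_max : 'I_N.+2) x.
  move=> xt; split; last by rewrite xknot_last ltry.
  by rewrite xknotS// inordN lte_fin.
split.
- move=> k kp x; rewrite /rescale.
  apply: (@cvgM R R); first exact: cvg_cst.
  apply: (@continuous_comp _ _ _ (fun x : R => r^-1 * x) (derivatives f k)).
    exact: mulrl_continuous.
  move: kp; rewrite leq_eqVlt => /predU1P[->|kp]; first exact: cf.
  by apply/differentiable_continuous/derivable1_diffP; exact: df.
- move=> k x kp /off[j xj].
  exact: (@jet_on_rescale _ _ r _ (jpf j) k x kp xj).
- move=> x /off[j xj]; rewrite helmholtzE iter_second_order_rescale// mul1r.
  rewrite -(iter_second_order_jet _ _ (jpf j))// ?(Lf j) ?mulr0// => y.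
  exact: near_piece.
- move=> x xt; have {}xt : r^-1 * x < t ord0.
    by rewrite -(ltr_pM2l r0) scaleK -inord0.
  rewrite iter_first_order_rescale// mulN1r.
  rewrite -(iter_first_order_jet _ _ (jpf ord0)) ?lf ?mulr0//.
  + by move=> y; exact: near_piece.
  + lia.
  + exact: left_piece.
- move=> x xt; have {}xt : t ord_max < r^-1 * x.
    by rewrite -(ltr_pM2l r0) scaleK -inordN.
  rewrite iter_first_order_rescale// mul1r.
  rewrite -(iter_first_order_jet _ _ (jpf ord_max)) ?rf ?mulr0//.
  + by move=> y; exact: near_piece.
  + lia.
  + exact: right_piece.
Qed.

Lemma exists_min_gap n (g : nat -> R) : (forall k, (k < n)%N -> 0 < g k) ->
  exists2 d : R, 0 < d & forall k, (k < n)%N -> d <= g k.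
Proof.
elim: n => [|n IHn] g0; first by exists 1.
have [k kn|d d0 dg] := IHn; first by apply: g0; exact: ltnW.
exists (Num.min d (g n)); first by rewrite lt_min d0 g0.
move=> k; rewrite ltnS leq_eqVlt => /predU1P[->|kn]; first by rewrite ge_min lexx orbT.
by rewrite ge_min dg.
Qed.

(** For [r >= 1/2] the rescaled gaps are at least [d / 2], where [d] bounds the original gaps from
    below, so one constant serves all [r]. Undoing the rescaling multiplies the derivative of order
    [m] by [r ^+ m]. *)
Lemma real_natural_spline_bound p N (t : 'I_N.+1 -> R) : (1 < p)%N ->
  (forall i j : 'I_N.+1, (i < j)%N -> t i < t j) ->
  exists2 C : R, 0 <= C & forall r f, 2^-1 <= r -> real_natural_spline p t r f ->
    (forall i, `|f (t i)| <= 1) ->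
    forall m x, (m <= 2 * p - 2)%N -> `|f^`(m) x| <= C * r ^+ m.
Proof.
move=> p1 tlt; have [k kN|d d0 dt] := @exists_min_gap N (fun k => t (inord k.+1) - t (inord k)).
  by rewrite subr_gt0 tlt// !inordK//; lia.
have d20 : 0 < d / 2 by rewrite divr_gt0.
have [C C0 hC] := @natural_jet_bound R p N _ p1 d20.
exists C => // r f r2 sf ft m x mp; have r0 : 0 < r by lra.
have rN0 : r != 0 by rewrite gt_eqF.
have : `|rescale r (derivatives f) m (r * x)| <= C.
  apply: (hC _ _ _ (natural_jet_rescale (ltnW p1) r0 sf)) => // k kN.
    have := dt k kN; rewrite -lerBrDl -mulrBr => dk.
    have : 2^-1 * d <= r * (t (inord k.+1) - t (inord k)) by apply: ler_pM => //; lra.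
    by rewrite mulrC.
  by rewrite /rescale expr0 invr1 mul1r mulKf.
rewrite /rescale mulKf// normrM ger0_norm ?invr_ge0 ?exprn_ge0 ?(ltW r0)//.
by rewrite ler_pdivrMl ?exprn_gt0// mulrC.
Qed.

End RealSpline.

(** * Passage between complex splines and their real and imaginary parts *)

Section ComplexSpline.
Context {R : realType}.
Implicit Types (a c : R) (s : R -> R[i]) (z w : R[i]).

Lemma Re_addZ a w z : complex.Re (w + a%:C * z) = complex.Re w + a * complex.Re z.
Proof. by case: w z => x y [x' y']; rewrite /= mul0r subr0. Qed.

Lemma Im_addZ a w z : complex.Im (w + a%:C * z) = complex.Im w + a * complex.Im z.
Proof. by case: w z => x y [x' y']; rewrite /= mul0r addr0. Qed.

Lemma Re_subZ a w z : complex.Re (w - a%:C * z) = complex.Re w - a * complex.Re z.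
Proof. by case: w z => x y [x' y']; rewrite /= mul0r subr0. Qed.

Lemma Im_subZ a w z : complex.Im (w - a%:C * z) = complex.Im w - a * complex.Im z.
Proof. by case: w z => x y [x' y']; rewrite /= mul0r addr0. Qed.

Lemma first_order_op_re p a s : re_part (first_order_op p a s) =
  iter p (fun g y => derive1n 1 g y + a * g y) (re_part s).
Proof.
elim: p => // p IHp; rewrite iterS -IHp; apply/funext => y.
by rewrite /re_part Re_addZ.
Qed.

Lemma first_order_op_im p a s : im_part (first_order_op p a s) =
  iter p (fun g y => derive1n 1 g y + a * g y) (im_part s).
Proof.
elim: p => // p IHp; rewrite iterS -IHp; apply/funext => y.
by rewrite /im_part Im_addZ.
Qed.

Lemma Lop_re n p (xi : 'rV[R]_n) s : re_part (Lop p xi s) =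
  iter p (fun g y => derive1n 2 g y - enorm xi ^+ 2 * g y) (re_part s).
Proof.
elim: p => // p IHp; rewrite iterS -IHp; apply/funext => y.
by rewrite /re_part Re_subZ.
Qed.

Lemma Lop_im n p (xi : 'rV[R]_n) s : im_part (Lop p xi s) =
  iter p (fun g y => derive1n 2 g y - enorm xi ^+ 2 * g y) (im_part s).
Proof.
elim: p => // p IHp; rewrite iterS -IHp; apply/funext => y.
by rewrite /im_part Im_subZ.
Qed.

Lemma natural_spline_re n p N (t : 'I_N.+1 -> R) (xi : 'rV[R]_n) s :
  natural_spline p t xi s -> real_natural_spline p t (enorm xi) (re_part s).
Proof.
case=> -[ds cs _] ps ls rs; split=> //.
- by move=> i x ip; have [] := ds i x ip I.
- by move=> j i x ip xj; have [dj _] := ps j; have [] := dj i x ip xj.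
- by move=> j x xj; rewrite -Lop_re /re_part; have [_ ->] := ps j.
- by move=> x xt; rewrite -first_order_op_re /re_part ls.
- by move=> x xt; rewrite -first_order_op_re /re_part rs.
Qed.

Lemma natural_spline_im n p N (t : 'I_N.+1 -> R) (xi : 'rV[R]_n) s :
  natural_spline p t xi s -> real_natural_spline p t (enorm xi) (im_part s).
Proof.
case=> -[ds _ cs] ps ls rs; split=> //.
- by move=> i x ip; have [] := ds i x ip I.
- by move=> j i x ip xj; have [dj _] := ps j; have [] := dj i x ip xj.
- by move=> j x xj; rewrite -Lop_im /im_part; have [_ ->] := ps j.
- by move=> x xt; rewrite -first_order_op_im /im_part ls.
- by move=> x xt; rewrite -first_order_op_im /im_part rs.
Qed.

Lemma normc_le_add (x y : R) : `|x +i* y| <= (`|x| + `|y|)%:C.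
Proof.
have xy0 : 0 <= `|x| + `|y| by rewrite addr_ge0.
rewrite normc_def lecR /= -(ger0_norm xy0) -sqrtr_sqr ler_sqrt ?sqr_ge0//.
rewrite sqrrD !real_normK ?num_real// addrAC lerDl mulrn_wge0// mulr_ge0//.
Qed.

End ComplexSpline.

Theorem theorem2p5 (R : realType) (p N : nat) (t : 'I_N.+1 -> R)
  (hN : (0 < N)%N) (hp2 : (2 <= p)%N) (hpN : (p <= N.+1)%N)
  (ht : forall i j : 'I_N.+1, (i < j)%N -> t i < t j) :
  exists2 C0 : R, 0 < C0 &
    forall (n : nat) (j : 'I_N.+1) (m : nat) (xi : 'rV[R]_n) (L : R -> R[i]),
      (0 < n)%N -> (m <= 2 * p - 2)%N -> 2^-1 <= enorm xi ->
      is_lagrange p t xi j L ->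
      forall x : R, `|cderiven m L x| <= (C0 * (1 + enorm xi ^+ m))%:C.
Proof.
have [C C0 hC] := real_natural_spline_bound hp2 ht.
(* The factor 2 adds up the real and imaginary parts; the 1 makes the constant positive even if
   [C = 0]. *)
exists (2 * C + 1); first by lra.
move=> n j m xi L _ mp xi2 [nL Lj Lk] x.
have re1 i : `|re_part L (t i)| <= 1.
  by rewrite /re_part; have [->|/Lk ->] := eqVneq i j; rewrite ?Lj/= ?normr1 ?normr0.
have im1 i : `|im_part L (t i)| <= 1.
  by rewrite /im_part; have [->|/Lk ->] := eqVneq i j; rewrite ?Lj/= ?normr0.
have reC := hC _ _ xi2 (natural_spline_re nL) re1 m x mp.
have imC := hC _ _ xi2 (natural_spline_im nL) im1 m x mp.
apply: le_trans (normc_le_add _ _) _; rewrite lecR.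
have xim : 0 <= enorm xi ^+ m by rewrite exprn_ge0//; lra.
by have := mulr_ge0 C0 xim; lra.
Qed.
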